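(* The system $\mathrm{RCA}_0^\omega+\mathrm{BW}_{\mathrm{net}}$ proves $\mathrm{HBU}$. Here $\mathrm{BW}_{\mathrm{net}}$ (the Bolzano-Weierstrass theorem for nets) is the statement that every net in $[0,1]$ indexed by a subset of Baire space has a convergent sub-net, and $\mathrm{HBU}$ is the statement that for every $\Psi:\mathbb{R}\to\mathbb{R}^+$ there are finitely many $y_1,\dots,y_k\in[0,1]$ such that $(\forall x\in[0,1])(\exists i\le k)\big(x\in(y_i-\Psi(y_i),y_i+\Psi(y_i))\big)$.
   Context: Base theory. Finite types: $0$ (natural numbers) is a type, and if $\sigma,\tau$ are types then so is $\sigma\to\tau$ (mappings from type $\sigma$ to type $\tau$ objects); $1:=0\to0$ and $n+1:=n\to0$; a superscript on a variable is its type. $L_\omega$ is the language with variables and quantifiers of all finite types, constants $0,1,<_0,+_0,\times_0,=_0$ on $\mathbb{N}$, the combinators $\Pi,\Sigma$ and a recursor constant $\mathbf{R}_0$. Equality at higher types is defined extensionally: $x=_\tau y$ iff $xz_1\dots z_k=_0yz_1\dots z_k$ for all arguments. $\mathrm{QF\text{-}AC}^{\sigma,\tau}$ is the schema $(\forall x^\sigma)(\exists y^\tau)A(x,y)\to(\exists Y^{\sigma\to\tau})(\forall x^\sigma)A(x,Y(x))$ for quantifier-free $A$ of $L_\omega$ (parameters of any type allowed). $\mathrm{RCA}_0^\omega$ is the theory in $L_\omega$ with classical logic and the axioms: $\mathbb{N}$ is an ordered semi-ring; the defining axioms of $\Pi,\Sigma$ (giving $\lambda$-abstraction); $\mathbf{R}_0(f,m,0)=m$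 and $\mathbf{R}_0(f,m,n+1)=f(n,\mathbf{R}_0(f,m,n))$; extensionality $x=_\rho y\to\varphi(x)=_\tau\varphi(y)$ for all types $\rho,\tau$ and $\varphi^{\rho\to\tau}$; induction for quantifier-free formulas of $L_\omega$; $\mathrm{QF\text{-}AC}^{1,0}$. Reals. A real is a sequence of rationals $(q_n)$ with $|q_n-q_{n+i}|<2^{-n}$ for all $n,i$ (a type 1 object); $(q_n)=_{\mathbb{R}}(r_n)$ iff $|q_n-r_n|\le2^{-n+1}$ for all $n$. A function $\mathbb{R}\to\mathbb{R}$ is a type $1\to1$ functional mapping equal reals to equal reals. Sets. A subset $D$ of Baire space $\mathbb{N}^{\mathbb{N}}$ is given by a characteristic function $F_D^2\le1$ ($f\in D$ means $F_D(f)=1$); a binary relation $\preceq$ on $D$ is likewise given by a characteristic function of type $(1\times1)\to0$. Via coding (and extensionality with respect to $=_{\mathbb{R}}$), subsets of $\mathbb{R}$ and sets of finite sequences of reals, and relations on them, are included. Nets. $(D,\preceq)$ with $D\neq\emptyset$ is directed if $\preceq$ is transitive and reflexive on $D$ and for all $x,y\in D$ there is $z\in D$ with $x\preceq z$ and $y\preceq z$. A net in $X\subseteq\mathbb{R}$ is a map $x_d:D\to X$ with $(D,\preceq)$ directed; all index sets are subsets of Baire space given by characteristic functions $F_D^2\le1$, with $\preceq$ given by a characteristic function of type $(1\times1)\to0$ (including, via coding, subsets of $\mathbb{R}$ and sets of finite sequences of reals). The net $x_d$ converges to $y$ if $(\forall\varepsilon>0)(\exists d_0\in D)(\forall e\succeq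 d_0)(|x_e-y|<\varepsilon)$. A sub-net of $x_d$ (index $(D,\preceq_D)$) is a net $y_b$ with directed index set $(B,\preceq_B)$ for which there is $\phi:B\to D$ with $y_b=x_{\phi(b)}$ for all $b\in B$ and $(\forall d\in D)(\exists b_0\in B)(\forall b\succeq_Bb_0)(\phi(b)\succeq_Dd)$. *)

(* Defs.v *)
From Stdlib Require Import List.
Import ListNotations.

Set Implicit Arguments.
Unset Strict Implicit.

(** * The language L_omega *)

Inductive ty : Set := ty0 | Arr (s t : ty).

Notation "s ⇒ t" := (Arr s t) (at level 55, right associativity).
Notation ty1 := (ty0 ⇒ ty0).
Notation ty2 := (ty1 ⇒ ty0).

(** [V t] is the set of variables of type [t] that may occur free. A binder of
    type [s] passes from [V] to [ext s V], which has one more variable of type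
    [s]. Sentences are formulas over [no_vars]. *)
Definition ctx := ty -> Set.

Inductive ext (s : ty) (V : ctx) : ty -> Set :=
| new : ext s V s
| old : forall t, V t -> ext s V t.

Arguments new {s V}.
Arguments old {s V t} _.

Definition no_vars : ctx := fun _ => Empty_set.

(** Arguments of type [1 x 1] are curried. *)
Inductive const : ty -> Set :=
| Zero : const ty0
| One : const ty0
| Plus : const (ty0 ⇒ ty0 ⇒ ty0)
| Times : const (ty0 ⇒ ty0 ⇒ ty0)
| Pi : forall s t, const (s ⇒ t ⇒ s)
| Sigma : forall r s t, const ((r ⇒ s ⇒ t) ⇒ (r ⇒ s) ⇒ r ⇒ t)
| Rec : const ((ty0 ⇒ ty0 ⇒ ty0) ⇒ ty0 ⇒ ty0 ⇒ ty0).

Inductive term (V : ctx) : ty -> Set :=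
| Var : forall t, V t -> term V t
| Cst : forall t, const t -> term V t
| App : forall s t, term V (s ⇒ t) -> term V s -> term V t.

Arguments Var {V t} _.
Arguments Cst {V t} _.
Arguments App {V s t} _ _.

(** Equality is primitive at type 0 only. The logic is classical, so the other
    connectives are abbreviations. *)
Inductive formula (V : ctx) : Set :=
| EqN : term V ty0 -> term V ty0 -> formula V
| LtN : term V ty0 -> term V ty0 -> formula V
| Bot : formula V
| Imp : formula V -> formula V -> formula V
| All : forall s, formula (ext s V) -> formula V.

Arguments Bot {V}.
Arguments All {V} s _.

Definition Not {V} (A : formula V) := Imp A Bot.
Definition And {V} (A B : formula V) := Not (Imp A (Not B)).
Definition Or {V} (A B : formula V) := Imp (Not A) B.
Definition Ex {V} s (A : formula (ext s V)) : formula V := Not (All s (Not A)).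

Fixpoint qf {V} (A : formula V) : Prop :=
  match A with
  | EqN _ _ | LtN _ _ | Bot => True
  | Imp A B => qf A /\ qf B
  | All _ _ => False
  end.

(** * Renaming and substitution *)

Definition ren (V W : ctx) := forall t, V t -> W t.
Definition sub (V W : ctx) := forall t, V t -> term W t.

Fixpoint ren_term {V W} (r : ren V W) t (a : term V t) : term W t :=
  match a with
  | Var v => Var (r _ v)
  | Cst c => Cst c
  | App f b => App (ren_term r f) (ren_term r b)
  end.

Fixpoint sub_term {V W} (r : sub V W) t (a : term V t) : term W t :=
  match a with
  | Var v => r _ v
  | Cst c => Cst c
  | App f b => App (sub_term r f) (sub_term r b)
  end.

Definition shift {V} s : ren V (ext s V) := fun t v => old v.

Definition scons {V W} s (a : term W s) (r : sub V W) : sub (ext s V) W :=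
  fun t v => match v in ext _ _ t return term W s -> term W t with
             | new => fun a => a
             | old v => fun _ => r _ v
             end a.

Definition up {V W} s (r : sub V W) : sub (ext s V) (ext s W) :=
  scons (Var new) (fun t v => ren_term (@shift W s) (r t v)).

Fixpoint sub_formula {V W} (r : sub V W) (A : formula V) : formula W :=
  match A with
  | EqN a b => EqN (sub_term r a) (sub_term r b)
  | LtN a b => LtN (sub_term r a) (sub_term r b)
  | Bot => Bot
  | Imp A B => Imp (sub_formula r A) (sub_formula r B)
  | All s A => All s (sub_formula (up r) A)
  end.

Definition inst {V s} (A : formula (ext s V)) (a : term V s) : formula V :=
  sub_formula (scons a (fun t v => Var v)) A.

Definition weaken {V s} (A : formula V) : formula (ext s V) :=
  sub_formula (fun t v => Var (old v)) A.

Definition close_in {V} (A : formula no_vars) : formula V :=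
  sub_formula (fun t (v : no_vars t) => match v with end) A.

(** * Classical natural deduction *)

(** A theory may have axioms with parameters, hence the index [V]. *)
Definition theory := forall V : ctx, formula V -> Prop.

Inductive deriv (T : theory) : forall V, list (formula V) -> formula V -> Prop :=
| d_ax : forall V (D : list (formula V)) A, T V A -> deriv T D A
| d_hyp : forall V (D : list (formula V)) A, In A D -> deriv T D A
| d_impI : forall V (D : list (formula V)) A B,
    deriv T (A :: D) B -> deriv T D (Imp A B)
| d_impE : forall V (D : list (formula V)) A B,
    deriv T D (Imp A B) -> deriv T D A -> deriv T D B
| d_raa : forall V (D : list (formula V)) A,
    deriv T (Not A :: D) Bot -> deriv T D A
| d_allI : forall V (D : list (formula V)) s (A : formula (ext s V)),
    deriv T (map weaken D) A -> deriv T D (All s A)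
| d_allE : forall V (D : list (formula V)) s (A : formula (ext s V)) a,
    deriv T D (All s A) -> deriv T D (inst A a)
| d_eqI : forall V (D : list (formula V)) a, deriv T D (EqN a a)
| d_eqE : forall V (D : list (formula V)) (A : formula (ext ty0 V)) a b,
    deriv T D (EqN a b) -> deriv T D (inst A a) -> deriv T D (inst A b).

Definition proves (T : theory) (A : formula no_vars) : Prop := deriv T [] A.

Definition add_axiom (T : theory) (A : formula no_vars) : theory :=
  fun V B => T V B \/ B = close_in A.

(** * Named binders *)

(** [↑a] reads the term [a] over [V] as a term over any context [W] that is
    reached from [V] by crossing binders; the crossing is inferred. *)
Class Emb (V W : ctx) := emb : ren V W.
#[global] Instance emb_refl V : Emb V V | 0 := fun t v => v.
#[global] Instance emb_step V W s (e : Emb V W) : Emb V (ext s W) | 1 :=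
  fun t v => old (e t v).

Definition lift {V W} {e : Emb V W} {t} (a : term V t) : term W t :=
  ren_term e a.

Definition all {V} s (A : term (ext s V) s -> formula (ext s V)) : formula V :=
  All s (A (Var new)).
Definition ex {V} s (A : term (ext s V) s -> formula (ext s V)) : formula V :=
  Ex (A (Var new)).

Arguments all {V} s _.
Arguments ex {V} s _.

Declare Scope L_scope.
Delimit Scope L_scope with L.
Bind Scope L_scope with term formula.
Local Open Scope L_scope.

Notation "↑ a" := (lift a) (at level 8, a at level 7, format "↑ a") : L_scope.
Notation "f · a" := (App f a) (at level 25, left associativity) : L_scope.
Notation "0" := (Cst Zero) : L_scope.
Notation "1" := (Cst One) : L_scope.
Notation "a + b" := (Cst Plus · a · b) : L_scope.
Notation "a * b" := (Cst Times · a · b) : L_scope.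

Notation "a ≐ b" := (EqN a b) (at level 70) : L_scope.
Notation "a < b" := (LtN a b) : L_scope.
Notation "a <= b" := (Or (LtN a b) (EqN a b)) : L_scope.
Notation "¬ A" := (Not A) (at level 75, right associativity) : L_scope.
Notation "A ∧ B" := (And A B) (at level 80, right associativity) : L_scope.
Notation "A ∨ B" := (Or A B) (at level 85, right associativity) : L_scope.
Notation "A ⟶ B" := (Imp A B) (at level 90, right associativity) : L_scope.
Notation "∀ x : s , A" := (all s (fun x => A))
  (at level 200, x name, s at level 60, A at level 200) : L_scope.
Notation "∃ x : s , A" := (ex s (fun x => A))
  (at level 200, x name, s at level 60, A at level 200) : L_scope.

Fixpoint eq_at {V} (t : ty) : term V t -> term V t -> formula V :=
  match t return term V t -> term V t -> formula V with
  | ty0 => fun a b => a ≐ b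
  | s ⇒ t => fun a b => ∀ z : s, eq_at (↑a · z) (↑b · z)
  end.

Notation "a ≐[ t ] b" := (@eq_at _ t a b) (at level 70) : L_scope.

(** * The base theory *)

(** That there is no number between 0 and 1, and none below 0, follows from
    quantifier-free induction. *)
Inductive RCA0w : theory :=
| add_assoc V : @RCA0w V (∀ x : ty0, ∀ y : ty0, ∀ z : ty0,
    (↑x + ↑y) + z ≐ ↑x + (↑y + z))
| add_comm V : @RCA0w V (∀ x : ty0, ∀ y : ty0, ↑x + y ≐ y + ↑x)
| add_0 V : @RCA0w V (∀ x : ty0, x + 0 ≐ x)
| mul_assoc V : @RCA0w V (∀ x : ty0, ∀ y : ty0, ∀ z : ty0,
    (↑x * ↑y) * z ≐ ↑x * (↑y * z))
| mul_comm V : @RCA0w V (∀ x : ty0, ∀ y : ty0, ↑x * y ≐ y * ↑x)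
| mul_1 V : @RCA0w V (∀ x : ty0, x * 1 ≐ x)
| mul_0 V : @RCA0w V (∀ x : ty0, x * 0 ≐ 0)
| mul_add V : @RCA0w V (∀ x : ty0, ∀ y : ty0, ∀ z : ty0,
    ↑x * (↑y + z) ≐ ↑x * ↑y + ↑x * z)
| lt_irrefl V : @RCA0w V (∀ x : ty0, ¬ x < x)
| lt_trans V : @RCA0w V (∀ x : ty0, ∀ y : ty0, ∀ z : ty0,
    ↑x < ↑y ⟶ ↑y < z ⟶ ↑x < z)
| lt_total V : @RCA0w V (∀ x : ty0, ∀ y : ty0, ↑x < y ∨ ↑x ≐ y ∨ y < ↑x)
| lt_0_1 V : @RCA0w V (0 < 1)
| lt_add V : @RCA0w V (∀ x : ty0, ∀ y : ty0, ∀ z : ty0,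
    ↑x < ↑y ⟶ ↑x + z < ↑y + z)
| lt_mul V : @RCA0w V (∀ x : ty0, ∀ y : ty0, ∀ z : ty0,
    0 < z ⟶ ↑x < ↑y ⟶ ↑x * z < ↑y * z)
| pi_eq V s t : @RCA0w V (∀ x : s, ∀ y : t, Cst (Pi s t) · ↑x · y ≐[s] ↑x)
| sigma_eq V r s t : @RCA0w V (∀ x : r ⇒ s ⇒ t, ∀ y : r ⇒ s, ∀ z : r,
    Cst (Sigma r s t) · ↑x · ↑y · z ≐[t] ↑x · z · (↑y · z))
| rec_0 V : @RCA0w V (∀ f : ty0 ⇒ ty0 ⇒ ty0, ∀ m : ty0, Cst Rec · ↑f · m · 0 ≐ m)
| rec_S V : @RCA0w V (∀ f : ty0 ⇒ ty0 ⇒ ty0, ∀ m : ty0, ∀ n : ty0,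
    Cst Rec · ↑f · ↑m · (n + 1) ≐ ↑f · n · (Cst Rec · ↑f · ↑m · n))
| extensionality V r t : @RCA0w V (∀ p : r ⇒ t, ∀ x : r, ∀ y : r,
    ↑x ≐[r] y ⟶ ↑p · ↑x ≐[t] ↑p · y)
| qf_induction V (A : formula (ext ty0 V)) : qf A -> @RCA0w V
    (inst A 0 ∧
     All ty0 (A ⟶ sub_formula (scons (Var new + 1) (fun t v => Var (old v))) A)
     ⟶ All ty0 A)
(** In [A] the innermost variable is the number [y] and the next one is [x]. *)
| qf_ac10 V (A : formula (ext ty0 (ext ty1 V))) : qf A -> @RCA0w V
    (All ty1 (Ex A) ⟶
     ∃ Y : ty1 ⇒ ty0, ∀ x : ty1,
       sub_formula (scons (↑Y · x) (scons x (fun t v => Var (old (old v))))) A).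

(** * Terms by abstraction and recursion *)

Fixpoint abs {V s t} (a : term (ext s V) t) : term V (s ⇒ t) :=
  match a in term _ t return term V (s ⇒ t) with
  | Var v => match v in ext _ _ t return term V (s ⇒ t) with
             | new => Cst (Sigma s (s ⇒ s) s) · Cst (Pi s (s ⇒ s)) · Cst (Pi s s)
             | @old _ _ t v => Cst (Pi t s) · Var v
             end
  | @Cst _ t c => Cst (Pi t s) · Cst c
  | @App _ r t f b => Cst (Sigma s r t) · abs f · abs b
  end.

Definition lam {V} s {t} (a : term (ext s V) s -> term (ext s V) t) :
    term V (s ⇒ t) := abs (a (Var new)).

Arguments lam {V} s {t} _.

Notation "'λ' x : s , a" := (lam s (fun x => a))
  (at level 200, x name, s at level 60, a at level 200) : L_scope.

Definition predN {V} (a : term V ty0) : term V ty0 :=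
  Cst Rec · (λ n : ty0, λ r : ty0, ↑n) · 0 · a.

Definition monus {V} (a b : term V ty0) : term V ty0 :=
  Cst Rec · (λ n : ty0, λ r : ty0, predN r) · a · b.

Notation "a ∸ b" := (monus a b) (at level 50, left associativity) : L_scope.

Definition pow2 {V} (a : term V ty0) : term V ty0 :=
  Cst Rec · (λ n : ty0, λ r : ty0, r + r) · 1 · a.

(** Integer square root: the root grows by one from [n] to [n + 1] exactly when
    [(r + 1)^2 <= n + 1]. *)
Definition isqrt {V} (a : term V ty0) : term V ty0 :=
  Cst Rec · (λ n : ty0, λ r : ty0, r + (1 ∸ ((r + 1) * (r + 1) ∸ (↑n + 1)))) · 0 · a.

(** The pairing is [(a, b) |-> (a + b)^2 + a]. *)
Definition pairN {V} (a b : term V ty0) : term V ty0 := (a + b) * (a + b) + a.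
Definition pr1 {V} (c : term V ty0) : term V ty0 := c ∸ isqrt c * isqrt c.
Definition pr2 {V} (c : term V ty0) : term V ty0 := isqrt c ∸ pr1 c.

(** * Rationals *)

(** Every number codes a rational: [((a, b), d)] codes [(a - b) / (d + 1)]. *)
Definition rat {V} (a b d : term V ty0) : term V ty0 := pairN (pairN a b) d.
Definition rpos {V} (q : term V ty0) : term V ty0 := pr1 (pr1 q).
Definition rneg {V} (q : term V ty0) : term V ty0 := pr2 (pr1 q).
Definition rden {V} (q : term V ty0) : term V ty0 := pr2 q + 1.

Definition rlt {V} (q r : term V ty0) : formula V :=
  rpos q * rden r + rneg r * rden q < rpos r * rden q + rneg q * rden r.
Definition rle {V} (q r : term V ty0) : formula V :=
  rpos q * rden r + rneg r * rden q <= rpos r * rden q + rneg q * rden r.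

Definition radd {V} (q r : term V ty0) : term V ty0 :=
  rat (rpos q * rden r + rpos r * rden q)
      (rneg q * rden r + rneg r * rden q)
      (rden q * rden r ∸ 1).
Definition ropp {V} (q : term V ty0) : term V ty0 := rat (rneg q) (rpos q) (pr2 q).
Definition rabs {V} (q : term V ty0) : term V ty0 :=
  rat ((rpos q ∸ rneg q) + (rneg q ∸ rpos q)) 0 (pr2 q).
Definition rdist {V} (q r : term V ty0) : term V ty0 := rabs (radd q (ropp r)).

(** [2^-n] and [2^(-n+1)]. *)
Definition eps {V} (n : term V ty0) : term V ty0 := rat 1 0 (pow2 n ∸ 1).
Definition eps2 {V} (n : term V ty0) : term V ty0 := rat (1 + 1) 0 (pow2 n ∸ 1).

(** * Reals *)

Definition is_real {V} (x : term V ty1) : formula V :=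
  ∀ n : ty0, ∀ i : ty0, rlt (rdist (↑x · ↑n) (↑x · (↑n + i))) (eps ↑n).

Definition eqR {V} (x y : term V ty1) : formula V :=
  ∀ n : ty0, rle (rdist (↑x · n) (↑y · n)) (eps2 n).
Definition ltR {V} (x y : term V ty1) : formula V :=
  ∃ n : ty0, rlt (radd (↑x · n) (eps2 n)) (↑y · n).
Definition leR {V} (x y : term V ty1) : formula V :=
  ∀ n : ty0, rle (↑x · n) (radd (↑y · n) (eps2 n)).

Definition zeroR {V} : term V ty1 := λ n : ty0, rat 0 0 0.
Definition oneR {V} : term V ty1 := λ n : ty0, rat 1 0 0.

(** The index shift restores the convergence rate of the sum. *)
Definition addR {V} (x y : term V ty1) : term V ty1 :=
  λ n : ty0, radd (↑x · (n + 1)) (↑y · (n + 1)).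
Definition oppR {V} (x : term V ty1) : term V ty1 := λ n : ty0, ropp (↑x · n).
Definition subR {V} (x y : term V ty1) : term V ty1 := addR x (oppR y).
Definition absR {V} (x : term V ty1) : term V ty1 := λ n : ty0, rabs (↑x · n).

Definition in_unit {V} (x : term V ty1) : formula V :=
  is_real x ∧ leR zeroR x ∧ leR x oneR.

(** * Nets *)

Definition char1 {V} (F : term V ty2) : formula V :=
  ∀ f : ty1, ↑F · f <= 1.
Definition char2 {V} (R : term V (ty1 ⇒ ty1 ⇒ ty0)) : formula V :=
  ∀ f : ty1, ∀ g : ty1, ↑R · ↑f · g <= 1.

Definition mem {V} (f : term V ty1) (D : term V ty2) : formula V := D · f ≐ 1.
Definition rel {V} (R : term V (ty1 ⇒ ty1 ⇒ ty0)) (f g : term V ty1) : formula V :=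
  R · f · g ≐ 1.

Definition directed {V} (D : term V ty2) (R : term V (ty1 ⇒ ty1 ⇒ ty0)) : formula V :=
  char1 D ∧ char2 R ∧
  (∃ d : ty1, mem d ↑D) ∧
  (∀ d : ty1, mem d ↑D ⟶ rel ↑R d d) ∧
  (∀ d : ty1, ∀ e : ty1, ∀ f : ty1,
     mem ↑d ↑D ⟶ mem ↑e ↑D ⟶ mem f ↑D ⟶
     rel ↑R ↑d ↑e ⟶ rel ↑R ↑e f ⟶ rel ↑R ↑d f) ∧
  (∀ d : ty1, ∀ e : ty1, mem ↑d ↑D ⟶ mem e ↑D ⟶
     ∃ f : ty1, mem f ↑D ∧ rel ↑R ↑d f ∧ rel ↑R ↑e f).

(** A map on [D] is given by a total functional, whose values outside [D] are
    irrelevant. *)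
Definition net {V} (D : term V ty2) (R : term V (ty1 ⇒ ty1 ⇒ ty0))
    (x : term V (ty1 ⇒ ty1)) : formula V :=
  directed D R ∧ ∀ d : ty1, mem d ↑D ⟶ is_real (↑x · d).

Definition net_in_unit {V} (D : term V ty2) (R : term V (ty1 ⇒ ty1 ⇒ ty0))
    (x : term V (ty1 ⇒ ty1)) : formula V :=
  net D R x ∧ ∀ d : ty1, mem d ↑D ⟶ in_unit (↑x · d).

Definition converges {V} (D : term V ty2) (R : term V (ty1 ⇒ ty1 ⇒ ty0))
    (x : term V (ty1 ⇒ ty1)) (y : term V ty1) : formula V :=
  ∀ e : ty1, is_real e ⟶ ltR zeroR e ⟶
  ∃ d0 : ty1, mem d0 ↑D ∧
  ∀ d : ty1, mem d ↑D ⟶ rel ↑R ↑d0 d ⟶ ltR (absR (subR (↑x · d) ↑y)) ↑e.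

Definition subnet {V} (B : term V ty2) (S : term V (ty1 ⇒ ty1 ⇒ ty0))
    (y : term V (ty1 ⇒ ty1)) (D : term V ty2) (R : term V (ty1 ⇒ ty1 ⇒ ty0))
    (x : term V (ty1 ⇒ ty1)) : formula V :=
  net B S y ∧
  ∃ p : ty1 ⇒ ty1,
    (∀ b : ty1, mem b ↑B ⟶ mem (↑p · b) ↑D ∧ eqR (↑y · b) (↑x · (↑p · b))) ∧
    (∀ d : ty1, mem d ↑D ⟶
       ∃ b0 : ty1, mem b0 ↑B ∧
       ∀ b : ty1, mem b ↑B ⟶ rel ↑S ↑b0 b ⟶ rel ↑R ↑d (↑p · b)).

Definition BW_net : formula no_vars :=
  ∀ D : ty2, ∀ R : ty1 ⇒ ty1 ⇒ ty0, ∀ x : ty1 ⇒ ty1,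
  net_in_unit ↑D ↑R x ⟶
  ∃ B : ty2, ∃ S : ty1 ⇒ ty1 ⇒ ty0, ∃ y : ty1 ⇒ ty1,
    subnet ↑B ↑S y ↑D ↑R ↑x ∧
    ∃ l : ty1, is_real l ∧ converges ↑B ↑S ↑y l.

(** * The Heine-Borel theorem for uncountable covers *)

Definition real_function {V} (P : term V (ty1 ⇒ ty1)) : formula V :=
  (∀ x : ty1, is_real x ⟶ is_real (↑P · x)) ∧
  (∀ x : ty1, ∀ y : ty1, is_real ↑x ⟶ is_real y ⟶ eqR ↑x y ⟶
     eqR (↑P · ↑x) (↑P · y)).

Definition positive_function {V} (P : term V (ty1 ⇒ ty1)) : formula V :=
  real_function P ∧ ∀ x : ty1, is_real x ⟶ ltR zeroR (↑P · x).

(** The finite sequence of reals is the restriction of [y] to indices below [k]. *)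
Definition HBU : formula no_vars :=
  ∀ P : ty1 ⇒ ty1, positive_function P ⟶
  ∃ k : ty0, ∃ y : ty0 ⇒ ty1,
    (∀ i : ty0, i < ↑k ⟶ in_unit (↑y · i)) ∧
    (∀ x : ty1, in_unit x ⟶
       ∃ i : ty0, i < ↑k ∧
         ltR (subR (↑y · i) (↑P · (↑y · i))) ↑x ∧
         ltR ↑x (addR (↑y · i) (↑P · (↑y · i)))).

(* Main.v *)
(** The calculus is complete for its Tarski semantics (Henkin), so it suffices to argue inside an
    arbitrary model of RCA_0^omega + BW_net. By extensionality the model can be taken with Leibniz
    equality at all types; its numbers embed in an ordered field of fractions, in which the
    rationals coded by the numbers take their values.

    Inside a model, suppose that [Psi] has no finite cover. Then for every finite sequence of reals
    and every [k] some rational in [0, 1] is uncovered up to [2^-k], and QF-AC^{1,0} picks such a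
    rational as a function of the sequence and [k]. Along a directed family of finite sequences in
    which, for every [l] in [0, 1], a point whose ball contains [l] eventually occurs, these
    rationals form a net, and the limit of a convergent sub-net would be uncovered: contradiction.
    Either every [l] lies in the ball of some rational, and then the initial segments of an
    enumeration of the rationals will do. Or some [l] lies in no such ball; then [Psi] is
    discontinuous at [l], which by Grilliot's trick yields the functional (E^2), and (E^2) decides
    inclusion between finite sequences of reals, so that all finite sequences can be used. *)

From HB Require Import structures.
From mathcomp Require Import all_boot all_order all_algebra.
From mathcomp Require Import boolp zify.
From Stdlib Require Import List Eqdep Cantor Ring.
Require Import Defs.

Set Implicit Arguments.
Unset Strict Implicit.
Unset Printing Implicit Defensive.

(** Reasoning about a model is classical and unrestricted, but whatever is handed to the net theorem
    or to choice (index set, order, net, sequence of centres) must be an element of the model. Hence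
    the notions [definable] and [decidable], semantic counterparts of terms and of quantifier-free
    formulas, with tactics that discharge them. The order of reals is not quantifier-free. Being
    uncovered is therefore stated for approximations at one finite stage, with an explicit margin
    and a bounded quantifier over the balls, so that it is decidable. All later constants keep these
    margins compatible. The case distinction comes from the order of the index set, which needs a
    characteristic function. Inclusion of finite sequences of reals involves an unbounded number
    quantifier; comparing lengths does not, but then the sequences must come from one fixed
    enumeration. A model may be nonstandard: lengths of finite sequences are numbers of the model,
    the field of fractions may fail to be Archimedean, and induction is available for decidable
    predicates. Estimates thus use only the ordered field axioms and the sequence [ep]. *)

Implicit Types V W X : ctx.

(** * Substitution *)

Lemma sub_eq V W (r r' : sub V W) : (forall t v, r t v = r' t v) -> r = r'.
Proof. by move=> h; apply: functional_extensionality_dep => t; apply: funext => v. Qed.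

Lemma eq_sub_term V W (r r' : sub V W) t (a : term V t) :
  (forall t v, r t v = r' t v) -> sub_term r a = sub_term r' a.
Proof. by move=> /sub_eq ->. Qed.

Lemma eq_sub_formula V W (r r' : sub V W) (A : formula V) :
  (forall t v, r t v = r' t v) -> sub_formula r A = sub_formula r' A.
Proof. by move=> /sub_eq ->. Qed.

Lemma sub_term_Var V t (a : term V t) : sub_term (fun t v => Var v) a = a.
Proof. by elim: a => //= {}t s f -> b ->. Qed.

Lemma ren_termE V W (r : ren V W) t (a : term V t) :
  ren_term r a = sub_term (fun t v => Var (r t v)) a.
Proof. by elim: a => //= {}t s f -> b ->. Qed.

Lemma sub_term_comp V W X (r : sub W X) (q : sub V W) t (a : term V t) :
  sub_term r (sub_term q a) = sub_term (fun t v => sub_term r (q t v)) a.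
Proof. by elim: a => //= {}t s f -> b ->. Qed.

Lemma sub_ren_term V W X (r : sub W X) (q : ren V W) t (a : term V t) :
  sub_term r (ren_term q a) = sub_term (fun t v => r t (q t v)) a.
Proof. by rewrite ren_termE sub_term_comp. Qed.

Lemma up_Var V s : up (fun t (v : V t) => Var v) = (fun t (v : ext s V t) => Var v).
Proof. by apply: sub_eq => t [|u v]. Qed.

Lemma sub_formula_Var V (A : formula V) : sub_formula (fun t v => Var v) A = A.
Proof.
elim: A => //= [{}V a b|{}V a b|{}V A -> B -> //|{}V s A IH].
- by rewrite !sub_term_Var.
- by rewrite !sub_term_Var.
- by rewrite up_Var IH.
Qed.

Lemma up_comp V W X s (r : sub W X) (q : sub V W) :
  (fun t v => sub_term (up r) (up q v)) =
  up (fun t v => sub_term r (q t v)) :> sub (ext s V) (ext s X).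
Proof.
apply: sub_eq => t [|u v] //=; rewrite /up /= sub_ren_term /= ren_termE sub_term_comp.
by apply: eq_sub_term => t' v' /=; rewrite ren_termE.
Qed.

Lemma sub_formula_comp V W X (r : sub W X) (q : sub V W) (A : formula V) :
  sub_formula r (sub_formula q A) = sub_formula (fun t v => sub_term r (q t v)) A.
Proof.
elim: A W X r q => //= [{}V a b|{}V a b|{}V A IHA B IHB|{}V s A IH] W X r q.
- by rewrite !sub_term_comp.
- by rewrite !sub_term_comp.
- by rewrite IHA IHB.
- by rewrite IH up_comp.
Qed.

Lemma sub_term_inst V W s (a : term W s) (r : sub V W) t (b : term V t) :
  sub_term (scons a r) (ren_term (@shift V s) b) = sub_term r b.
Proof. by rewrite sub_ren_term. Qed.

Lemma sub_ren_up V W s (r : sub V W) t (a : term V t) :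
  sub_term (up r) (ren_term (fun t v => old v) a) =
  ren_term (@shift W s) (sub_term r a).
Proof.
rewrite sub_ren_term ren_termE sub_term_comp; apply: eq_sub_term => u v.
by rewrite /up /= ren_termE.
Qed.

Lemma scons_up V W X s (a : term X s) (r : sub W X) (q : sub V W) :
  (fun t v => sub_term (scons a r) (up q v)) =
  scons a (fun t v => sub_term r (q t v)).
Proof. by apply: sub_eq => t [|u v] //=; rewrite /up /= sub_ren_term. Qed.

Lemma inst_sub_up V W s (A : formula (ext s V)) (r : sub V W) a :
  inst (sub_formula (up r) A) a = sub_formula (scons a r) A.
Proof.
rewrite /inst sub_formula_comp scons_up; congr (sub_formula (scons a _) A).
by apply: sub_eq => t v; rewrite sub_term_Var.
Qed.

Lemma sub_inst V W s (A : formula (ext s V)) (r : sub V W) a :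
  sub_formula r (inst A a) = inst (sub_formula (up r) A) (sub_term r a).
Proof.
rewrite inst_sub_up /inst sub_formula_comp; by apply: eq_sub_formula => t [|u v].
Qed.

Lemma sub_weaken V W s (r : sub V W) (A : formula V) :
  sub_formula (up r) (weaken (s := s) A) = weaken (sub_formula r A).
Proof.
rewrite /weaken !sub_formula_comp; by apply: eq_sub_formula => t v; rewrite /up /= ren_termE.
Qed.

Lemma sub_inst_comp V W s (A : formula (ext s V)) (r : sub V W) a :
  sub_formula r (inst A a) = sub_formula (scons (sub_term r a) r) A.
Proof. by rewrite sub_inst inst_sub_up. Qed.

Lemma sub_eq_at V W (r : sub V W) t (a b : term V t) :
  sub_formula r (eq_at a b) = eq_at (sub_term r a) (sub_term r b).
Proof.
elim: t V W r a b => //= s IHs t IHt V W r a b.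
by rewrite /all IHt /= /lift !sub_ren_up.
Qed.

Lemma qf_sub V W (r : sub V W) (A : formula V) : qf A -> qf (sub_formula r A).
Proof. by elim: A W r => //= {}V A IHA B IHB W r [/IHA h /IHB k]. Qed.

(** * Derivations *)

(** Axioms may contain parameters. Closure under substitution lets a whole derivation be substituted
    into, both to generalize a fresh variable and to replace free variables by closed terms. *)
Definition stable (T : theory) : Prop :=
  forall V W (r : sub V W) (A : formula V), T V A -> T W (sub_formula r A).

Lemma deriv_sub (T : theory) V W (r : sub V W) D (A : formula V) :
  stable T -> deriv T D A -> deriv T (List.map (sub_formula r) D) (sub_formula r A).
Proof.
move=> sT h; elim: h W r => {V D A}.
- by move=> V D A h W r; apply/d_ax/sT.
- by move=> V D A h W r; apply: d_hyp; apply: in_map.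
- by move=> V D A B _ IH W r; apply: d_impI; apply: IH.
- by move=> V D A B _ IH1 _ IH2 W r; apply: d_impE (IH2 _ _); apply: IH1.
- by move=> V D A _ IH W r; apply: d_raa; apply: IH.
- move=> V D s A _ IH W r; apply: d_allI; move: (IH _ (up r)).
  by rewrite !map_map; under map_ext => B do rewrite sub_weaken.
- by move=> V D s A a _ IH W r; rewrite sub_inst; apply: d_allE; apply: IH.
- by move=> *; apply: d_eqI.
- move=> V D A a b _ IH1 _ IH2 W r; rewrite sub_inst.
  by apply: (d_eqE (IH1 _ _)); rewrite -sub_inst.
Qed.

Lemma deriv_incl (T : theory) V D D' (A : formula V) :
  deriv T D A -> incl D D' -> deriv T D' A.
Proof.
move=> h; elim: h D' => {V D A}.
- by move=> V D A h D' i; apply: d_ax.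
- by move=> V D A h D' i; apply/d_hyp/i.
- move=> V D A B _ IH D' i; apply/d_impI/IH => x /= [<-|/i]; by [left|right].
- by move=> V D A B _ IH1 _ IH2 D' i; apply: d_impE (IH2 _ i); apply: IH1.
- move=> V D A _ IH D' i; apply/d_raa/IH => x /= [<-|/i]; by [left|right].
- by move=> V D s A _ IH D' i; apply/d_allI/IH/incl_map.
- by move=> V D s A a _ IH D' i; apply/d_allE/IH.
- by move=> *; apply: d_eqI.
- by move=> V D A a b _ IH1 _ IH2 D' i; apply: (d_eqE (IH1 _ i)); apply: IH2.
Qed.

Lemma RCA0w_stable : stable RCA0w.
Proof.
move=> V W r A h; case: h r => {V A} V; rewrite /all /=;
  try (by move=> r; constructor).
- move=> s t r; rewrite sub_eq_at; exact: pi_eq.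
- move=> p s t r; rewrite sub_eq_at; exact: sigma_eq.
- move=> s t r; rewrite !sub_eq_at; exact: extensionality.
- move=> A qA r.
  have := qf_induction (qf_sub (up r) qA).
  rewrite sub_inst; congr (RCA0w (Imp (And _ (All _ (Imp _ _))) _)).
  rewrite !sub_formula_comp; apply: eq_sub_formula => t [|u v] //=.
  by rewrite /up /= sub_ren_term ren_termE.
- move=> A qA r.
  have := qf_ac10 (qf_sub (up (up r)) qA).
  congr (RCA0w (Imp _ (Ex (All _ _)))).
  rewrite !sub_formula_comp; apply: eq_sub_formula => t [|u [|u' v]] //=.
by rewrite /up /= !sub_ren_term /= !ren_termE sub_term_comp.
Qed.

Lemma add_axiom_stable T A : stable T -> stable (add_axiom T A).
Proof.
move=> sT V W r B [/(sT _ _ r)|->]; [by left|right].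
by rewrite /close_in sub_formula_comp; apply: eq_sub_formula => t [].
Qed.

(** * Countability of the language *)

Definition npair (m n : nat) : nat := Cantor.to_nat (m, n).
Arguments npair : simpl never.

Lemma npair_inj m n m' n' : npair m n = npair m' n' -> m = m' /\ n = n'.
Proof.
by move=> /(congr1 Cantor.of_nat); rewrite !Cantor.cancel_of_to => -[-> ->].
Qed.

Fixpoint code_ty (t : ty) : nat :=
  match t with
  | ty0 => 0
  | s ⇒ t => S (npair (code_ty s) (code_ty t))
  end.

Lemma code_ty_inj t t' : code_ty t = code_ty t' -> t = t'.
Proof.
elim: t t' => [|s IHs t IHt] [|s' t'] //= [] /npair_inj [/IHs -> /IHt ->] //.
Qed.

Definition code_const t (c : const t) : nat :=
  match c with
  | Zero => 0
  | One => 1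
  | Plus => 2
  | Times => 3
  | Rec => 4
  | Pi s t => 5 + 2 * npair (code_ty s) (code_ty t)
  | Sigma r s t =>
      6 + 2 * npair (code_ty r) (npair (code_ty s) (code_ty t))
  end.

Lemma code_const_inj t (c : const t) t' (c' : const t') :
  code_const c = code_const c' -> existT const t c = existT const t' c'.
Proof.
case: c => [||||s1 t1|r1 s1 t1|]; case: c' => [||||s2 t2|r2 s2 t2|] //= h;
  try (exfalso; lia).
- have /npair_inj [/code_ty_inj -> /code_ty_inj ->] //:
    npair (code_ty s1) (code_ty t1) = npair (code_ty s2) (code_ty t2).
  by lia.
- have /npair_inj [/code_ty_inj -> /npair_inj [/code_ty_inj -> /code_ty_inj ->]] //:
    npair (code_ty r1) (npair (code_ty s1) (code_ty t1)) =
    npair (code_ty r2) (npair (code_ty s2) (code_ty t2)).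
  by lia.
Qed.

(** Injectivity is asked across all types at once: the type of the argument is hidden in an
    application, so equal codes have to determine it. *)
Definition var_coding V (c : forall t, V t -> nat) : Prop :=
  forall t v t' v', c t v = c t' v' -> existT V t v = existT V t' v'.

Definition code_ext V (c : forall t, V t -> nat) s t (v : ext s V t) : nat :=
  match v with new => 0 | old u w => S (c u w) end.

Lemma code_ext_inj V c s : @var_coding V c -> var_coding (@code_ext V c s).
Proof.
move=> ci t v t' v'; case: v => [|u v]; case: v' => [|u' v'] //= [] /ci h.
have e := f_equal (@projT1 _ _) h; move: e h => /= e; case: u' / e v' => v' h.
by rewrite (inj_pair2 _ _ _ _ _ h).
Qed.

Fixpoint code_term V (c : forall t, V t -> nat) t (a : term V t) : nat :=
  match a with
  | Var t v => 3 * npair (code_ty t) (c t v)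
  | Cst t k => 3 * code_const k + 1
  | App s t f b => 3 * npair (code_term c f) (code_term c b) + 2
  end.

Lemma code_term_inj V c : @var_coding V c -> var_coding (@code_term V c).
Proof.
move=> ci t a; elim: a => {t} [t v|t k|s t f IHf b IHb] t' [u v'|u k'|s' u f' b'] /= h;
  try (exfalso; lia).
- have /npair_inj [_ /ci e] : npair (code_ty t) (c t v) = npair (code_ty u) (c u v')
    by lia.
  have e' := f_equal (@projT1 _ _) e; move: e' e => /= e; case: u / e v' {h} => v' e.
  by rewrite (inj_pair2 _ _ _ _ _ e).
- have /code_const_inj e : code_const k = code_const k' by lia.
  have e' := f_equal (@projT1 _ _) e; move: e' e => /= e; case: u / e k' {h} => k' e.
  by rewrite (inj_pair2 _ _ _ _ _ e).
- have /npair_inj [/IHf e /IHb e'] : npair (code_term c f) (code_term c b) =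
    npair (code_term c f') (code_term c b') by lia.
  have [] := f_equal (@projT1 _ _) e => es et.
  case: s' / es f' b' e e' {h} => f' b' e e'; case: u / et f' e => f' e.
  by rewrite (inj_pair2 _ _ _ _ _ e) (inj_pair2 _ _ _ _ _ e').
Qed.

Fixpoint code_formula V (c : forall t, V t -> nat) (A : formula V) : nat :=
  match A with
  | EqN a b => 5 * npair (code_term c a) (code_term c b)
  | LtN a b => 5 * npair (code_term c a) (code_term c b) + 1
  | Bot => 2
  | Imp A B => 5 * npair (code_formula c A) (code_formula c B) + 3
  | All s A => 5 * npair (code_ty s) (code_formula (@code_ext V c s) A) + 4
  end.

Lemma code_formula_inj V c : @var_coding V c -> injective (@code_formula V c).
Proof.
move=> ci A; elim: A c ci => {V} [V a b|V a b|V|V A IHA B IHB|V s A IH] c ci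
  [a' b'|a' b'||A' B'|s' A'] /= h; try (exfalso; lia); try by [].
- have /npair_inj [/(code_term_inj ci) e /(code_term_inj ci) e'] :
    npair (code_term c a) (code_term c b) = npair (code_term c a') (code_term c b')
    by lia.
  by rewrite (inj_pair2 _ _ _ _ _ e) (inj_pair2 _ _ _ _ _ e').
- have /npair_inj [/(code_term_inj ci) e /(code_term_inj ci) e'] :
    npair (code_term c a) (code_term c b) = npair (code_term c a') (code_term c b')
    by lia.
  by rewrite (inj_pair2 _ _ _ _ _ e) (inj_pair2 _ _ _ _ _ e').
- have /npair_inj [/(IHA _ ci) -> /(IHB _ ci) ->] // :
    npair (code_formula c A) (code_formula c B) =
    npair (code_formula c A') (code_formula c B') by lia.
- have /npair_inj [/code_ty_inj e h'] : npair (code_ty s) (code_formula (@code_ext V c s) A) =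
    npair (code_ty s') (code_formula (@code_ext V c s') A') by lia.
  by case: s' / e A' {h} h' => A' /(IH _ (code_ext_inj ci)) ->.
Qed.

(** * Maximal consistent Henkin sets *)

(** Semantic form of a bound on the free variables: substitutions that agree on the variables of
    level below [N] have the same effect on [A]. *)
Definition supported V (l : forall t, V t -> nat) N (A : formula V) : Prop :=
  forall W (r r' : sub V W), (forall t v, l t v < N -> r t v = r' t v) ->
  sub_formula r A = sub_formula r' A.

Lemma supported_mono V l N N' (A : formula V) :
  supported l N A -> N <= N' -> supported l N' A.
Proof. by move=> sA le W r r' e; apply: sA => t v lt; apply: e; lia. Qed.

Lemma term_support V (l : forall t, V t -> nat) t (a : term V t) :
  exists N, forall W (r r' : sub V W), (forall t v, l t v < N -> r t v = r' t v) ->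
  sub_term r a = sub_term r' a.
Proof.
elim: a => {t} [t v|t c|s t f [N hf] b [N' hb]].
- by exists (S (l t v)) => W r r' e /=; apply: e.
- by exists 0.
- exists (maxn N N') => W r r' e /=; congr App.
    by apply: hf => t' v h; apply: e; lia.
  by apply: hb => t' v h; apply: e; lia.
Qed.

Definition level_ext V (l : forall t, V t -> nat) s t (v : ext s V t) : nat :=
  match v with new => 0 | old u w => l u w end.

Lemma formula_support V (l : forall t, V t -> nat) (A : formula V) :
  exists N, supported l N A.
Proof.
elim: A l => {V} [V a b|V a b|V|V A IHA B IHB|V s A IH] l.
- have [[N h] [N' h']] := (term_support l a, term_support l b).
  exists (maxn N N') => W r r' e /=; rewrite (h _ r r') ?(h' _ r r') // => t v k;
    by apply: e; lia.
- have [[N h] [N' h']] := (term_support l a, term_support l b).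
  exists (maxn N N') => W r r' e /=; rewrite (h _ r r') ?(h' _ r r') // => t v k;
    by apply: e; lia.
- by exists 0.
- have [[N h] [N' h']] := (IHA l, IHB l).
  exists (maxn N N') => W r r' e /=; rewrite (h _ r r') ?(h' _ r r') // => t v k;
    by apply: e; lia.
- have [N h] := IH (@level_ext V l s).
  exists N => W r r' e /=; congr All; apply: h => t [|u v] //= k.
  by rewrite /up /= e.
Qed.

Lemma list_support V (l : forall t, V t -> nat) (D : list (formula V)) :
  exists N, forall A, In A D -> supported l N A.
Proof.
elim: D => [|B D [N h]]; first by exists 0.
have [N' h'] := formula_support l B.
exists (maxn N N') => A [<-|/h k]; [apply: supported_mono h' _|apply: supported_mono k _]; lia.
Qed.

(** Variables play the part of Henkin constants. With countably many at each type, finitely many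
    formulas always leave a fresh one, and the language stays as it is. *)
Definition num_vars : ctx := fun _ => nat.
Definition num_level t (v : num_vars t) : nat := v.

(** Inverse to instantiating the bound variable by variable [N] of type [s]. Every type has a
    variable numbered [N], hence the test on types. *)
Definition abstract_var s (N : nat) : sub num_vars (ext s num_vars) :=
  fun t v =>
    if v == N then
      match pselect (s = t) with
      | left e => Var (eq_rect s (ext s num_vars) new t e)
      | right _ => Var (old v)
      end
    else Var (old v).

Lemma abstract_var_lt s N t (v : num_vars t) : num_level v < N -> abstract_var s N v = Var (old v).
Proof. by rewrite /abstract_var /num_level; case: eqP => // ->; rewrite ltnn. Qed.

Lemma abstract_var_eq s N : abstract_var s N (N : num_vars s) = Var new.
Proof. by rewrite /abstract_var eqxx; case: pselect => // e; rewrite (Prop_irrelevance e erefl). Qed.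

(** Substituting the bound variable for variable [N] turns the given refutation into one over the
    extended context; by the bounds on support, the assumptions in [D] are merely weakened and the
    instance of [B] becomes [B] itself. *)
Lemma fresh_generalization T s (B : formula (ext s num_vars)) D N :
  stable T -> (forall A, In A D -> supported num_level N A) ->
  supported (@level_ext _ num_level s) N B ->
  deriv T (Not (inst B (Var (N : num_vars s))) :: D) Bot -> deriv T D (All s B).
Proof.
move=> sT sD sB h; apply/d_allI/d_raa; have := deriv_sub (abstract_var s N) sT h.
rewrite /= sub_inst_comp /= abstract_var_eq.
rewrite (sB _ _ (fun t v => Var v)) ?sub_formula_Var; last first.
  by move=> t [|u v] //= lt; rewrite abstract_var_lt.
congr (deriv T (_ :: _) _); apply: map_ext_in => A /sD sA; apply: sA => t v lt.
by rewrite abstract_var_lt.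
Qed.

Lemma formula_enumeration : exists e : nat -> formula num_vars, forall A, exists n, e n = A.
Proof.
pose c := code_formula (fun t (v : num_vars t) => npair (code_ty t) v).
have ci : injective c.
  apply: (@code_formula_inj num_vars (fun t v => npair (code_ty t) v)) => t v t' v'.
  by move=> /npair_inj [/code_ty_inj e ev]; case: t' / e v' ev => v' ->.
exists (fun n => if pselect (exists A, c A = n) is left h then sval (cid h) else Bot).
move=> A; exists (c A); case: pselect => [h|[]]; last by exists A.
by apply: ci; case: (cid h).
Qed.

Section Henkin.
Variables (T : theory) (sT : stable T).

Definition consistent V (D : list (formula V)) : Prop := ~ deriv T D Bot.

(** One stage of the Lindenbaum-Henkin construction. A refuted universal formula comes with a
    counterexample at a variable beyond all supports, which is consistent by
    [fresh_generalization]. *)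
Lemma henkin_step (D : list (formula num_vars)) A : consistent D ->
  exists D', [/\ consistent D', incl D D', In A D' \/ In (Not A) D' &
    forall s B, A = All s B -> In (Not A) D' -> exists c, In (Not (inst B c)) D'].
Proof.
move=> cD; have [k|k] := pselect (consistent (A :: D)).
  exists (A :: D); split => //; [by move=> x; right|by left; left|].
  move=> s B e [h|h]; first by have := f_equal (fun C => if C is Imp _ _ then 1 else 0) h;
    rewrite e.
  case: k; apply: (d_impE (A := A)); last by apply: d_hyp; left.
  by apply: d_hyp; right.
have {k} nA : deriv T D (Not A) by apply: d_impI; apply: contrapT.
have cD' : consistent (Not A :: D).
  by move=> h; apply: cD; apply: d_impE nA; apply: d_impI.
have [[s [B eA]]|nAll] := pselect (exists s B, A = All s B); last first.
  exists (Not A :: D); split => //; [by move=> x; right|by right; left|].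
  by move=> s B e; case: nAll; exists s, B.
have [N hN] := list_support num_level (Not A :: D).
have [N' hN'] := formula_support (@level_ext _ num_level s) B.
pose c := Var ((maxn N N' : nat) : num_vars s).
exists (Not (inst B c) :: Not A :: D); split.
- move=> /(fresh_generalization (N := maxn N N') sT) h; apply: (cD').
  apply: (d_impE (A := A)); first by apply: d_hyp; left.
  rewrite {2}eA; apply: h => [C /hN k|]; [apply: supported_mono k _|apply: supported_mono hN' _]; lia.
- by move=> x h; right; right.
- by right; right; left.
- move=> s' B'; rewrite eA => -[] es; case: s' / es B' => B' h _.
  by exists c; left; rewrite (inj_pair2 _ _ _ _ _ h).
Qed.

Lemma henkin_extension (D : list (formula num_vars)) : consistent D ->
  exists G : formula num_vars -> Prop,
  [/\ forall A, In A D -> G A,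
      forall A, deriv T nil A -> G A,
      ~ G Bot,
      forall A B, G (Imp A B) <-> (G A -> G B) &
      forall s B, G (All s B) <-> forall c, G (inst B c)].
Proof.
move=> cD; have [e eP] := formula_enumeration.
have next (p : {D : list (formula num_vars) | consistent D}) A :
  {q : {D : list (formula num_vars) | consistent D} | [/\ incl (sval p) (sval q),
      In A (sval q) \/ In (Not A) (sval q) &
    forall s B, A = All s B -> In (Not A) (sval q) -> exists c, In (Not (inst B c)) (sval q)]}.
  by apply: cid; have [D' [c ? ? ?]] := henkin_step A (svalP p); exists (exist _ D' c).
pose fix stage n := if n is S m then sval (next (stage m) (e m)) else exist _ D cD.
pose G A := exists n, In A (sval (stage n)).
have mono m n : m <= n -> incl (sval (stage m)) (sval (stage n)).
  move=> /subnKC <-; elim: (n - m) => [|k IH]; first by rewrite addn0; exact: incl_refl.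
  by rewrite addnS /=; apply: incl_tran IH _; case: (next _ _) => q [].
(* [G] is deductively closed: a derivable formula is decided at its own stage, and its negation
   there would make a later stage inconsistent. *)
have GE A : G A <-> exists n, deriv T (sval (stage n)) A.
  split=> [[n h]|[n h]]; first by exists n; apply: d_hyp.
  have [m em] := eP A; have [_ dec _] := svalP (next (stage m) (e m)).
  exists (S m); rewrite /=; case: dec; rewrite em // => k.
  have := svalP (stage (maxn n (S m))); case.
  apply: (d_impE (A := A)); last by apply: deriv_incl h _; apply: mono; lia.
  by apply: d_hyp; apply: (mono (S m)); [lia|rewrite /= em].
have Gjoin A B C : G A -> G B -> (forall D, deriv T D A -> deriv T D B -> deriv T D C) -> G C.
  move=> /GE [n hA] /GE [m hB] h; apply/GE; exists (maxn n m).
  by apply: h; [apply: deriv_incl hA _|apply: deriv_incl hB _]; apply: mono; lia.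
have Gnot A : ~ G A -> G (Not A).
  have [m em] := eP A; have [_ dec _] := svalP (next (stage m) (e m)).
  by move=> nA; exists (S m); rewrite /=; case: dec; rewrite em // => k; case: nA; exists (S m);
    rewrite /= em.
have Gbot : ~ G Bot by move=> /GE [n h]; apply: (svalP (stage n)).
exists G; split => //.
- by move=> A h; exists 0.
- by move=> A h; apply/GE; exists 0; apply: deriv_incl h _.
- move=> A B; split=> [h k|h].
    by apply: Gjoin h k _ => D' h k; apply: d_impE h k.
  have [/h k|/Gnot k] := pselect (G A).
    apply: (Gjoin _ _ _ k k) => D' k' _; apply: d_impI.
    by apply: deriv_incl k' _ => x; right.
  apply: (Gjoin _ _ _ k k) => D' k' _; apply/d_impI/d_raa/(d_impE (A := A)).
    by apply: deriv_incl k' _ => x; right; right.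
  by apply: d_hyp; right; left.
- move=> s B; split=> [h c|h].
    by apply: (Gjoin _ _ _ h h) => D' k _; apply: d_allE.
  apply: contrapT => nG; have [m em] := eP (All s B).
  have [_ dec wit] := svalP (next (stage m) (e m)).
  case: dec; rewrite em => k; first by apply: nG; exists (S m); rewrite /= em.
  have [|c hc] := wit s B em; first by rewrite em.
  apply: Gbot; apply: (Gjoin (Not (inst B c)) (inst B c)) (h c) _; first by exists (S m).
  by move=> D'; apply: d_impE.
Qed.

End Henkin.

(** * Extensional models *)

Record structure : Type := Structure {
  dom : ty -> Type;
  app : forall s t, dom (s ⇒ t) -> dom s -> dom t;
  cst : forall t, const t -> dom t;
  lt : dom ty0 -> dom ty0 -> Prop
}.
Arguments app {_ s t} _ _.
Arguments cst {_ t} _.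
Arguments lt {_} _ _.

Definition env (M : structure) V := forall t, V t -> dom M t.

Definition econs (M : structure) V s (x : dom M s) (e : env M V) : env M (ext s V) :=
  fun t v => match v in ext _ _ t return dom M s -> dom M t with
             | new => fun x => x
             | old _ v => fun _ => e _ v
             end x.

Definition no_env (M : structure) : env M no_vars := fun t v => match v with end.

Fixpoint eval (M : structure) V (e : env M V) t (a : term V t) : dom M t :=
  match a with
  | Var _ v => e _ v
  | Cst _ c => cst c
  | App _ _ f b => app (eval e f) (eval e b)
  end.

Fixpoint holds (M : structure) V (e : env M V) (A : formula V) : Prop :=
  match A with
  | EqN a b => eval e a = eval e b
  | LtN a b => lt (eval e a) (eval e b)
  | Bot => False
  | Imp A B => holds e A -> holds e B
  | All s A => forall x, holds (econs x e) A
  end.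

Definition extensional (M : structure) : Prop :=
  forall s t (f g : dom M (s ⇒ t)), (forall x, app f x = app g x) -> f = g.

Definition models (T : theory) (M : structure) : Prop :=
  forall V (A : formula V) (e : env M V), T V A -> holds e A.

Lemma env_eq (M : structure) V (e e' : env M V) : (forall t v, e t v = e' t v) -> e = e'.
Proof. by move=> h; apply: functional_extensionality_dep => t; apply: funext => v. Qed.

Lemma eval_ren (M : structure) V W (e : env M W) (r : ren V W) t (a : term V t) :
  eval e (ren_term r a) = eval (fun t v => e t (r t v)) a.
Proof. by elim: a => //= {}t s f -> b ->. Qed.

(** * Quotients *)

(** Classes are predicates, and [rep] chooses a representative, so operations can be defined on
    representatives and their compatibility proved afterwards. Both the term model and the field of
    fractions are built this way. *)
Definition quot (U : Type) (E : U -> U -> Prop) : Type := {P : U -> Prop | exists x, P = E x}.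
Definition cls (U : Type) (E : U -> U -> Prop) (x : U) : quot E :=
  exist _ (E x) (ex_intro _ x erefl).
Definition rep (U : Type) (E : U -> U -> Prop) (q : quot E) : U := sval (cid (svalP q)).

Lemma cls_rep U (E : U -> U -> Prop) (q : quot E) : cls E (rep q) = q.
Proof.
rewrite /rep; case: cid => x /=; case: q => P h /= e.
by subst P; congr exist; exact: Prop_irrelevance.
Qed.

Section Quotient.
Variables (U : Type) (E : U -> U -> Prop).
Hypotheses (Exx : forall x, E x x) (Esym : forall x y, E x y -> E y x)
  (Etrans : forall x y z, E x y -> E y z -> E x z).

Lemma cls_eq x y : cls E x = cls E y <-> E x y.
Proof.
split=> [[->] //|h]; suff e : E x = E y.
  by rewrite /cls; move: (ex_intro _ x _); rewrite e => p; congr exist; exact: Prop_irrelevance.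
by apply: funext => z; apply: propext; split; [apply/Etrans/Esym|apply: Etrans].
Qed.

End Quotient.

(** * The model of terms modulo equality in a Henkin set *)

Section TermModel.
Variables (T : theory) (G : formula num_vars -> Prop).
Hypotheses (RCA0w_T : forall V (A : formula V), RCA0w A -> T A)
  (sT : stable T)
  (GT : forall A, deriv T nil A -> G A)
  (GBot : ~ G Bot)
  (GImp : forall A B, G (Imp A B) <-> (G A -> G B))
  (GAll : forall s B, G (All s B) <-> forall c, G (inst B c)).

Let tm := term num_vars.

Definition teq t (a b : tm t) : Prop := G (eq_at a b).

Lemma teq_arr s t (a b : tm (s ⇒ t)) : teq a b <-> forall c, teq (App a c) (App b c).
Proof.
rewrite /teq /= /all GAll; split=> h c; move: (h c); rewrite /inst sub_eq_at /=;
  by rewrite /lift !sub_ren_term !sub_term_Var.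
Qed.

Lemma GEq (A : formula (ext ty0 num_vars)) a b : G (EqN a b) -> G (inst A a) -> G (inst A b).
Proof.
move=> h; apply/GImp; move: h; apply/GImp; apply: GT; do 2 apply: d_impI.
by apply: (d_eqE (a := a)); apply: d_hyp; [right; left|left].
Qed.

Lemma inst_lift s t (a : tm t) (c : tm s) :
  sub_term (scons c (fun t v => Var v)) (ren_term (@shift _ s) a) = a.
Proof. by rewrite sub_term_inst sub_term_Var. Qed.

Lemma teq_refl t (a : tm t) : teq a a.
Proof. elim: t a => [|s _ t IH] a; [exact/GT/d_eqI|by apply/teq_arr => c]. Qed.

Lemma teq_sym t (a b : tm t) : teq a b -> teq b a.
Proof.
elim: t a b => [|s _ t IH] a b; last by move=> /teq_arr h; apply/teq_arr => c; apply: IH.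
move=> h; have := GEq (A := EqN (Var new) (ren_term (@shift _ ty0) a)) h.
by rewrite /inst /= !inst_lift; apply; exact: (@teq_refl ty0).
Qed.

Lemma teq_trans t (a b c : tm t) : teq a b -> teq b c -> teq a c.
Proof.
elim: t a b c => [|s _ t IH] a b c; last first.
  by move=> /teq_arr h /teq_arr k; apply/teq_arr => d; apply: IH (h d) (k d).
move=> h k; have := GEq (A := EqN (ren_term (@shift _ ty0) a) (Var new)) k.
by rewrite /inst /= !inst_lift; apply.
Qed.

Lemma GAll3 s1 s2 s3 (A : formula (ext s3 (ext s2 (ext s1 num_vars)))) c1 c2 c3 :
  G (All s1 (All s2 (All s3 A))) ->
  G (sub_formula (scons c3 (scons c2 (scons c1 (fun t v => Var v)))) A).
Proof.
set r1 := scons c1 _ => /GAll /(_ c1) h.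
have := (GAll (sub_formula (up r1) (All s3 A))).1 h c2; rewrite inst_sub_up => {}h.
have := (GAll (sub_formula (up (scons c2 r1)) A)).1 h c3.
by rewrite inst_sub_up.
Qed.

(** Compatibility in the function is the definition of equality at arrow types; compatibility in the
    argument is the extensionality axiom. *)
Lemma teq_app s t (f g : tm (s ⇒ t)) (a b : tm s) : teq f g -> teq a b -> teq (App f a) (App g b).
Proof.
move=> /teq_arr h k; apply: teq_trans (h b) => {h g}.
have := GAll3 f a b
  (GT (d_ax nil (RCA0w_T (@extensionality num_vars s t)))).
rewrite /= !sub_eq_at /= /lift => /GImp; exact.
Qed.

Definition term_model : structure :=
  @Structure (fun t => quot (@teq t)) (fun s t f a => cls _ (App (rep f) (rep a)))
    (fun t c => cls _ (Cst c)) (fun x y => G (LtN (rep x) (rep y))).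

Definition tcls t (a : tm t) : dom term_model t := cls _ a.

Lemma tcls_eq t (a b : tm t) : tcls a = tcls b <-> teq a b.
Proof. apply: cls_eq; [exact: teq_refl|exact: teq_sym|exact: teq_trans]. Qed.

Lemma tcls_rep t (x : dom term_model t) : tcls (rep x) = x.
Proof. exact: cls_rep. Qed.

Lemma teq_rep t (a : tm t) : teq (rep (tcls a)) a.
Proof. by apply/tcls_eq; exact: tcls_rep. Qed.

Lemma tcls_app s t (f : tm (s ⇒ t)) a : app (tcls f) (tcls a) = tcls (App f a).
Proof. by apply/tcls_eq/teq_app; apply: teq_rep. Qed.

Lemma tcls_lt (a b : tm ty0) : lt (tcls a) (tcls b) <-> G (LtN a b).
Proof.
rewrite /lt /=; set a' := rep _; set b' := rep _.
have w (c c' d d' : tm ty0) : teq c c' -> teq d d' -> G (LtN c d) -> G (LtN c' d').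
  move=> h k l.
  have := GEq (A := LtN (Var new) (ren_term (@shift _ ty0) d)) h.
  rewrite /inst /= !inst_lift => /(_ l) => {}l.
  have := GEq (A := LtN (ren_term (@shift _ ty0) c') (Var new)) k.
  by rewrite /inst /= !inst_lift => /(_ l).
by split; apply: w; try apply: teq_rep; apply: teq_sym; apply: teq_rep.
Qed.

Lemma eval_tcls V (r : sub V num_vars) t (a : term V t) :
  eval (M := term_model) (fun t v => tcls (r t v)) a = tcls (sub_term r a).
Proof. by elim: a => // {}t s f IHf b IHb; rewrite -tcls_app -IHf -IHb. Qed.

Lemma holds_tcls V (r : sub V num_vars) (A : formula V) :
  holds (M := term_model) (fun t v => tcls (r t v)) A <-> G (sub_formula r A).
Proof.
elim: A r => {V} [V a b|V a b|V|V A IHA B IHB|V s A IH] r /=.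
- by rewrite !eval_tcls; apply: tcls_eq.
- by rewrite !eval_tcls; apply: tcls_lt.
- by [].
- by rewrite GImp IHA IHB.
- rewrite GAll; split=> h c.
    rewrite inst_sub_up -IH; have := h (tcls c); congr holds.
    by apply: env_eq => t [|u v].
  have := h (rep c); rewrite inst_sub_up -IH; congr holds.
  by apply: env_eq => t [|u v] //=; rewrite tcls_rep.
Qed.

Lemma term_model_models : models T term_model.
Proof.
move=> V A e h; have -> : e = fun t v => tcls (rep (e t v)).
  by apply: env_eq => t v; rewrite tcls_rep.
by apply/holds_tcls/GT/d_ax/sT.
Qed.

(** Every element is the class of a term, and by the witness property agreement on all terms puts
    the universal statement into [G], which is equality at the arrow type. *)
Lemma term_model_extensional : extensional term_model.
Proof.
move=> s t f g h; rewrite -(tcls_rep f) -(tcls_rep g); apply/tcls_eq/teq_arr => c.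
by apply/tcls_eq; rewrite -!tcls_app !tcls_rep.
Qed.

End TermModel.

(** Inhabits every type by constant functions. Put for the variables of a refutation over
    [num_vars], these terms bring it back to [no_vars]; they also serve as default values in
    models. *)
Fixpoint closed_term V t : term V t :=
  match t with
  | ty0 => Cst Zero
  | s ⇒ t => App (Cst (Pi t s)) (closed_term V t)
  end.

Theorem completeness (T : theory) (A : formula no_vars) :
  (forall V (B : formula V), RCA0w B -> T V B) -> stable T ->
  (forall M, extensional M -> models T M -> holds (@no_env M) A) ->
  proves T A.
Proof.
move=> RT sT h; apply: contrapT => nA.
pose e : sub no_vars num_vars := fun t v => match v with end.
have cA : consistent T (cons (Not (sub_formula e A)) nil).
  move=> k; apply: nA; apply: d_raa.
  have := deriv_sub (fun t _ => closed_term no_vars t) sT k.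
  rewrite /= sub_formula_comp; congr (deriv _ (cons (Not _) _) _).
  by rewrite -[RHS]sub_formula_Var; apply: eq_sub_formula => t [].
have [G [GA GT GB GI GAll]] := henkin_extension sT cA.
have nG : ~ G (sub_formula e A).
  by move=> k; apply: GB; move: k; apply/GI/GA; left.
apply: nG; rewrite -(holds_tcls RT GT GB GI GAll).
have := h _ (term_model_extensional RT GT GI GAll) (term_model_models RT sT GT GB GI GAll).
by congr holds; apply: env_eq => t [].
Qed.

(** * Definable functions of a model *)

Record model : Type := Model {
  str :> structure;
  model_ext : extensional str;
  model_ax : models RCA0w str
}.

Declare Scope dom_scope.
Delimit Scope dom_scope with D.
Arguments app {_ s t} _%_D _%_D.
Arguments lt {_} _%_D _%_D.
Notation "f • x" := (app f x) (at level 25, left associativity) : dom_scope.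
Local Open Scope dom_scope.

Section Definable.
Variable M : model.
Local Notation dom := (dom M).

Lemma holds_eq_at V (e : env M V) t (a b : term V t) : holds e (eq_at a b) <-> eval e a = eval e b.
Proof.
elim: t V e a b => //= s _ t IH V e a b; split=> [h|h x]; last first.
  by apply/IH; rewrite /= /lift !eval_ren /= h.
apply: (@model_ext M) => x; have /IH := h x.
by rewrite /= /lift !eval_ren.
Qed.

Lemma PiE s t (x : dom s) (y : dom t) : cst (Pi s t) • x • y = x.
Proof. by have /= /holds_eq_at := model_ax (@no_env M) (@pi_eq no_vars s t) x y. Qed.

Lemma SigmaE r s t (x : dom (r ⇒ s ⇒ t)) (y : dom (r ⇒ s)) (z : dom r) :
  cst (Sigma r s t) • x • y • z = x • z • (y • z).
Proof. by have /= /holds_eq_at := model_ax (@no_env M) (@sigma_eq no_vars r s t) x y z. Qed.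

(** The head of [C] is the variable bound last and becomes the last argument. Abstracting over it
    thus keeps the same coding element, as [definable_Lam] exploits. *)
Fixpoint arrs (C : list ty) (t : ty) : ty :=
  match C with nil => t | cons s C => arrs C (s ⇒ t) end.

Fixpoint tuples (C : list ty) : Type :=
  match C with nil => unit | cons s C => (tuples C * dom s)%type end.

Fixpoint apps (C : list ty) (t : ty) : dom (arrs C t) -> tuples C -> dom t :=
  match C with
  | nil => fun g _ => g
  | cons s C => fun g p => apps (t := s ⇒ t) g p.1 • p.2
  end.

(** The witness is any element of the model, so parameters are allowed. *)
Definition definable (C : list ty) t (F : tuples C -> dom t) : Prop :=
  exists g, forall p, F p = apps g p.

Lemma definable_const C t (c : dom t) : definable (fun _ : tuples C => c).
Proof.
elim: C t c => [|s C IH] t c; first by exists c.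
by have [g gE] := IH _ (cst (Pi t s) • c); exists g => -[p x] /=; rewrite -gE PiE.
Qed.

(** Bracket abstraction: [Sigma] hands the last argument to both sides, and the induction removes
    the remaining ones. *)
Lemma definable_app C s t (F : tuples C -> dom (s ⇒ t)) G :
  definable F -> definable G -> definable (fun p => F p • G p).
Proof.
move=> [f fE] [g gE]; suff [h hE] : definable (fun p => apps f p • apps g p).
  by exists h => p; rewrite fE gE.
elim: C s t f g {F G fE gE} => [|r C IH] s t f g; first by exists (f • g).
have [k kE] := definable_const C (cst (Sigma r s t)).
have [h hE] := IH _ _ k f; have [h' h'E] := IH _ _ h g.
by exists h' => -[p x]; rewrite /= -h'E -hE -kE SigmaE.
Qed.

Lemma definable_weaken C s t (F : tuples C -> dom t) :
  definable F -> definable (fun p : tuples (cons s C) => F p.1).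
Proof.
move=> h; have [g gE] := definable_app (definable_const C (cst (Pi t s))) h.
by exists g => -[p x] /=; rewrite -gE PiE.
Qed.

Lemma definable_var C s : definable (fun p : tuples (cons s C) => p.2).
Proof.
pose i := cst (Sigma s (s ⇒ s) s) • cst (Pi s (s ⇒ s)) • cst (Pi s s) : dom (s ⇒ s).
have [g gE] := definable_const C i.
by exists g => -[p x] /=; rewrite -gE SigmaE PiE.
Qed.

(** Total on all functions of the metatheory, with a default value where no element represents [F].
    Nested abstractions can thus be written down first and their definability checked when they are
    evaluated. *)
Definition Lam s t (F : dom s -> dom t) : dom (s ⇒ t) :=
  if pselect (exists f, forall x, f • x = F x) is left h then sval (cid h)
  else eval (@no_env M) (closed_term no_vars _).

Lemma definable_Lam C s t (F : tuples C -> dom s -> dom t) :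
  definable (fun p : tuples (cons s C) => F p.1 p.2) -> definable (fun p => Lam (F p)).
Proof.
move=> [g gE]; exists g => p; rewrite /Lam; case: pselect => [h|[]].
  by apply: (@model_ext M) => x; case: (cid h) => f /= ->; exact: (gE (p, x)).
by exists (@apps C (s ⇒ t) g p) => x; rewrite (gE (p, x)).
Qed.

Lemma LamE s t (F : dom s -> dom t) x :
  definable (fun p : tuples (cons s nil) => F p.2) -> Lam F • x = F x.
Proof.
move=> [g gE]; rewrite /Lam; case: pselect => [h|[]]; first by case: (cid h).
by exists g => y; rewrite (gE (tt, y)).
Qed.

End Definable.

Arguments definable {M} C {t} F.
Notation "'fn' x : s => a" := (Lam (fun x : dom _ s => a))
  (at level 200, x name, s at level 60, a at level 200) : dom_scope.

Lemma definable_var1 (M : model) C s0 s : definable (s0 :: s :: C) (fun p : tuples M _ => p.1.2).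
Proof. exact: (@definable_weaken M (s :: C) s0 s (fun p => p.2) (definable_var M C s)). Qed.
Lemma definable_var2 (M : model) C s0 s1 s :
  definable (s0 :: s1 :: s :: C) (fun p : tuples M _ => p.1.1.2).
Proof. exact: (@definable_weaken M (s1 :: s :: C) s0 s (fun p => p.1.2) (definable_var1 M C s1 s)). Qed.
Lemma definable_var3 (M : model) C s0 s1 s2 s :
  definable (s0 :: s1 :: s2 :: s :: C) (fun p : tuples M _ => p.1.1.1.2).
Proof. exact: (@definable_weaken M (s1 :: s2 :: s :: C) s0 s (fun p => p.1.1.2) (definable_var2 M C s1 s2 s)). Qed.
Lemma definable_var4 (M : model) C s0 s1 s2 s3 s :
  definable (s0 :: s1 :: s2 :: s3 :: s :: C) (fun p : tuples M _ => p.1.1.1.1.2).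
Proof.
exact: (@definable_weaken M (s1 :: s2 :: s3 :: s :: C) s0 s (fun p => p.1.1.1.2)
  (definable_var3 M C s1 s2 s3 s)).
Qed.

Ltac definability :=
  cbn beta;
  first [ exact: definable_const | exact: definable_var | exact: definable_var1
        | exact: definable_var2 | exact: definable_var3 | exact: definable_var4
        | refine (definable_Lam _); definability
        | refine (definable_app _ _); definability ].

#[global] Hint Extern 0 (definable _ _) => definability : core.

(** * Arithmetic in a model *)

Lemma eval_sub (M : structure) V W (e : env M W) (r : sub V W) t (a : term V t) :
  eval e (sub_term r a) = eval (fun t v => eval e (r t v)) a.
Proof. by elim: a => //= {}t s f -> b ->. Qed.

Lemma holds_sub (M : structure) V W (e : env M W) (r : sub V W) (A : formula V) :
  holds e (sub_formula r A) <-> holds (fun t v => eval e (r t v)) A.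
Proof.
elim: A W e r => {V} [V a b|V a b|V|V A IHA B IHB|V s A IH] W e r /=; rewrite ?eval_sub //.
- by rewrite IHA IHB.
- split=> h x; have /= := h x; rewrite IH; congr holds; apply: env_eq => t [|u v] //=;
    by rewrite /up /= eval_ren.
Qed.

Section Operations.
Variable M : model.
Local Notation dom := (dom M).
Local Notation num := (dom ty0).
Implicit Types (x y z m n : num).

Definition zero : num := cst Zero.
Definition one : num := cst One.
Definition plus x y : num := cst Plus • x • y.
Definition times x y : num := cst Times • x • y.
Definition le x y : Prop := lt x y \/ x = y.
Definition Rec (f : dom (ty0 ⇒ ty0 ⇒ ty0)) x n : num := cst Rec • f • x • n.

End Operations.
Arguments plus {M} x%_D y%_D.
Arguments times {M} x%_D y%_D.
Arguments le {M} x%_D y%_D.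
Arguments zero {M}.
Arguments one {M}.
Notation "0" := zero : dom_scope.
Notation "1" := one : dom_scope.
Notation "x + y" := (plus x y) : dom_scope.
Notation "x * y" := (times x y) : dom_scope.
Notation "x < y" := (lt x y) : dom_scope.
Notation "x <= y" := (le x y) : dom_scope.

Section Arithmetic.
Variable M : model.
Local Notation dom := (dom M).
Local Notation num := (dom ty0).
Implicit Types (x y z m n : num).

Let ax (A : formula no_vars) (h : RCA0w A) : holds (@no_env M) A := model_ax (@no_env M) h.

Lemma plusA x y z : (x + y) + z = x + (y + z).
Proof. exact: (ax (@add_assoc no_vars)). Qed.
Lemma plusC x y : x + y = y + x.
Proof. exact: (ax (@add_comm no_vars)). Qed.
Lemma plus0 x : x + 0 = x.
Proof. exact: (ax (@add_0 no_vars)). Qed.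
Lemma timesA x y z : (x * y) * z = x * (y * z).
Proof. exact: (ax (@Defs.mul_assoc no_vars)). Qed.
Lemma timesC x y : x * y = y * x.
Proof. exact: (ax (@Defs.mul_comm no_vars)). Qed.
Lemma times1 x : x * 1 = x.
Proof. exact: (ax (@mul_1 no_vars)). Qed.
Lemma times0 x : x * 0 = 0.
Proof. exact: (ax (@mul_0 no_vars)). Qed.
Lemma timesD x y z : x * (y + z) = x * y + x * z.
Proof. exact: (ax (@mul_add no_vars)). Qed.
Lemma num_ltxx x : ~ x < x.
Proof. exact: (ax (@lt_irrefl no_vars)). Qed.
Lemma lt_tr x y z : x < y -> y < z -> x < z.
Proof. exact: (ax (@lt_trans no_vars)). Qed.
Lemma lt_cases x y : [\/ x < y, x = y | y < x].
Proof.
have h := ax (@lt_total no_vars) x y; rewrite /= in h.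
have [k|k] := pselect (x < y); first by constructor 1.
have [k'|k'] := pselect (x = y); first by constructor 2.
by constructor 3; apply: h.
Qed.
Lemma lt01 : lt (0 : num) 1.
Proof. exact: (ax (@lt_0_1 no_vars)). Qed.
Lemma lt_plus x y z : x < y -> x + z < y + z.
Proof. exact: (ax (@lt_add no_vars)). Qed.
Lemma lt_times x y z : 0 < z -> x < y -> x * z < y * z.
Proof. exact: (ax (@lt_mul no_vars)). Qed.
Lemma Rec0 f m : Rec f m 0 = m :> num.
Proof. exact: (ax (@rec_0 no_vars)). Qed.
Lemma RecS f m n : Rec f m (n + 1) = f • n • Rec f m n :> num.
Proof. exact: (ax (@rec_S no_vars)). Qed.

Lemma num_semiring : semi_ring_theory zero one (@plus M) (@times M) eq.
Proof.
split=> *; rewrite -?plusA -?timesA //.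
- by rewrite plusC plus0.
- exact: plusC.
- by rewrite timesC times1.
- by rewrite timesC times0.
- exact: timesC.
- by rewrite timesC timesD; congr plus; exact: timesC.
Qed.
Add Ring num_ring : num_semiring.

Lemma qf_ind V (e : env M V) (A : formula (ext ty0 V)) : qf A ->
  holds (econs 0 e) A -> (forall n, holds (econs n e) A -> holds (econs (n + 1) e) A) ->
  forall n, holds (econs n e) A.
Proof.
move=> qA h0 hS; have /= := model_ax e (qf_induction qA); apply; apply.
  by rewrite holds_sub; move: h0; congr holds; apply: env_eq => t [|u v].
move=> x /hS h; rewrite holds_sub; move: h; congr holds; apply: env_eq => t [|u v] //.
Qed.

(** Induction for one fixed shape of formula. The general [num_ind] codes predicates as zero sets
    and so relies on truncated subtraction, whose basic properties are obtained from this
    instance. *)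
Lemma bootstrap_ind (f g h k f' g' : dom ty1) :
  let P n := f • n = g • n \/ (h • n < k • n /\ f' • n = g' • n) in
  P 0 -> (forall n, P n -> P (n + 1)) -> forall n, P n.
Proof.
move=> P P0 PS n.
pose W := ext ty1 (ext ty1 (ext ty1 (ext ty1 (ext ty1 (ext ty1 no_vars))))).
pose e : env M W := econs f (econs g (econs h (econs k (econs f' (econs g' (@no_env M)))))).
pose ap (v : W ty1) : term (ext ty0 W) ty0 := App (Var (old v)) (Var new).
pose A : formula (ext ty0 W) :=
  Or (EqN (ap new) (ap (old new)))
   (Defs.And (LtN (ap (old (old new))) (ap (old (old (old new)))))
     (EqN (ap (old (old (old (old new))))) (ap (old (old (old (old (old new)))))))).
have AE m : holds (econs m e) A <-> P m.
  rewrite /P /=; split=> [H|[->|[a b]] //]; last by move=> _ /(_ a b).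
  have [?|/H H'] := pselect (f • m = g • m); [by left|right].
  by split; apply: contrapT => c; apply: H' => a b; apply: c.
by apply/AE; apply: qf_ind => //; [apply/AE|move=> m /AE /PS /AE].
Qed.

Definition pred_fun : dom ty1 :=
  locked (fn n : ty0 => Rec (fn n : ty0 => fn r : ty0 => n) 0 n).

Lemma pred0 : pred_fun • 0 = 0.
Proof. by rewrite /pred_fun -lock LamE // Rec0. Qed.

Lemma predS n : pred_fun • (n + 1) = n.
Proof. by rewrite /pred_fun -lock LamE // RecS !LamE. Qed.

Lemma lt_S n : n < n + 1.
Proof. by have := lt_plus n lt01; rewrite (plusC 0) plus0 plusC. Qed.

Lemma num_cases n : n = 0 \/ (0 < n /\ n = pred_fun • n + 1).
Proof.
have /= := @bootstrap_ind (fn n : ty0 => n) (fn n : ty0 => 0) (fn n : ty0 => 0)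
 (fn n : ty0 => n) (fn n : ty0 => n) (fn n : ty0 => pred_fun • n + 1).
move=> /(_ _ _ n); rewrite !LamE //; apply; first by left.
move=> {}n; rewrite !LamE // predS => h; right; split => //.
by case: h => [->|[h _]]; [exact: lt_S|apply: lt_tr h _; exact: lt_S].
Qed.

Definition monus_fun : dom (ty0 ⇒ ty0 ⇒ ty0) :=
  locked (fn m : ty0 => fn n : ty0 => Rec (fn n : ty0 => fn r : ty0 => pred_fun • r) m n).
Definition monus m n : num := monus_fun • m • n.
Local Notation "m ∸ n" := (monus m n).

Lemma monus0 m : m ∸ 0 = m.
Proof. by rewrite /monus /monus_fun -lock !LamE // Rec0. Qed.

Lemma monusS m n : m ∸ (n + 1) = pred_fun • (m ∸ n).
Proof. by rewrite /monus /monus_fun -lock !LamE // RecS !LamE. Qed.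

Lemma monus_cases m n : m = n + (m ∸ n) \/ (m < n /\ m ∸ n = 0).
Proof.
have /= := @bootstrap_ind (fn n : ty0 => m) (fn n : ty0 => n + (m ∸ n)) (fn n : ty0 => m)
 (fn n : ty0 => n) (fn n : ty0 => m ∸ n) (fn n : ty0 => 0).
move=> /(_ _ _ n); rewrite !LamE //; apply.
  by left; rewrite monus0 plusC plus0.
move=> {}n; rewrite !LamE // monusS => -[e|[lt ->]]; last first.
  by right; rewrite pred0; split=> //; apply: lt_tr lt (lt_S _).
case: (num_cases (m ∸ n)) => [e0|[_ e1]].
  by right; rewrite {1}e e0 pred0 plus0; split; first exact: lt_S.
by left; rewrite plusA (plusC 1) -e1.
Qed.

Lemma ge0 n : 0 <= n.
Proof. by case: (num_cases n) => [->|[h _]]; [right|left]. Qed.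

Lemma S_neq0 n : n + 1 <> 0.
Proof.
by move=> e; have := lt_S n; rewrite e; case: (ge0 n) => [h /(lt_tr h)|<-] /num_ltxx.
Qed.

Lemma le_subK m n : m <= n -> n = m + (n ∸ m).
Proof.
by case: (monus_cases n m) => // -[h _] [/(lt_tr h) /num_ltxx //|e]; move: h; rewrite e => /num_ltxx.
Qed.

Lemma le_antisym m n : m <= n -> n <= m -> m = n.
Proof. by move=> [h|//] [/(lt_tr h) /num_ltxx|->]. Qed.

Lemma num_le_total m n : m <= n \/ n <= m.
Proof.
by case: (lt_cases m n) => h; [left; left|left; right|right; left].
Qed.

Lemma le_plus m n p : m <= n -> m + p <= n + p.
Proof. by move=> [h|->]; [left; apply: lt_plus|right]. Qed.

Lemma le_addr m n : m <= m + n.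
Proof. by have := le_plus m (ge0 n); rewrite plusC plus0 plusC. Qed.

Lemma le_plus2 m n m' n' : m <= n -> m' <= n' -> m + m' <= n + n'.
Proof.
move=> h k; rewrite (le_subK h) (le_subK k).
suff -> : m + (n ∸ m) + (m' + (n' ∸ m')) = m + m' + ((n ∸ m) + (n' ∸ m')) by apply: le_addr.
ring.
Qed.

Lemma le_times m n p : m <= n -> m * p <= n * p.
Proof.
case: (num_cases p) => [-> _|[p0 _]]; first by right; rewrite !times0.
by move=> [h|->]; [left; apply: lt_times|right].
Qed.

Lemma plus_cancel m n p : m + p = n + p -> m = n.
Proof.
by move=> e; case: (lt_cases m n) => // /(lt_plus p); rewrite e => /num_ltxx.
Qed.

Lemma times_cancel m n p : m * (p + 1) = n * (p + 1) -> m = n.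
Proof.
have p0 : 0 < p + 1 by case: (ge0 p) => [h|<-]; [apply: lt_tr h (lt_S _)|exact: lt_S].
by move=> e; case: (lt_cases m n) => // /(lt_times p0); rewrite e => /num_ltxx.
Qed.

Lemma le_times_cancel m n p : m * (p + 1) <= n * (p + 1) -> m <= n.
Proof.
move=> h; case: (num_le_total m n) => // k; right; apply: (@times_cancel _ _ p).
by apply: le_antisym h _; apply: le_times.
Qed.

End Arithmetic.
Arguments monus {M} m%_D n%_D.
Notation "m ∸ n" := (monus m n) : dom_scope.

(** * The ordered field of fractions *)

Section Fractions.
Variable M : model.
Local Notation num := (dom M ty0).
Add Ring num_ring : (num_semiring M).

(* [(a, b, d)] stands for [(a - b) / (d + 1)], so that no denominator vanishes. *)
Let triple : Type := (num * num * num)%type.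
Implicit Types (x y z : triple).

Definition frac_eq x y : Prop :=
  x.1.1 * (y.2 + 1) + y.1.2 * (x.2 + 1) = y.1.1 * (x.2 + 1) + x.1.2 * (y.2 + 1).

Lemma frac_eq_refl x : frac_eq x x.
Proof. by []. Qed.

Lemma frac_eq_sym x y : frac_eq x y -> frac_eq y x.
Proof. by move=> h; symmetry. Qed.

Lemma frac_eq_trans x y z : frac_eq x y -> frac_eq y z -> frac_eq x z.
Proof.
case: x y z => [[a b] d] [[a' b'] d'] [[a'' b''] d'']; rewrite /frac_eq /= => h k.
(* In a semiring one cannot subtract: the two hypotheses are multiplied by the outer denominators
   and added, and the terms of the middle triple, present on both sides, are cancelled. *)
apply: (@times_cancel M _ _ d').
apply: (@plus_cancel M _ _ ((b' * (d'' + 1)) * (d + 1) + a' * (d + 1) * (d'' + 1))).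
transitivity ((a * (d' + 1) + b' * (d + 1)) * (d'' + 1) +
  (a' * (d'' + 1) + b'' * (d' + 1)) * (d + 1)).
  by ring.
by rewrite h k; ring.
Qed.

Definition frac : Type := quot frac_eq.
Definition mk x : frac := cls frac_eq x.

Lemma mk_eq x y : mk x = mk y <-> frac_eq x y.
Proof. exact: (cls_eq frac_eq_refl frac_eq_sym frac_eq_trans). Qed.

Lemma mk_rep (q : frac) : mk (rep q) = q.
Proof. exact: cls_rep. Qed.

Lemma frac_ind (P : frac -> Prop) : (forall x, P (mk x)) -> forall q, P q.
Proof. by move=> h q; rewrite -(mk_rep q). Qed.

(** The last component is the product of the denominators minus one, written without subtraction. *)
Definition add3 x y : triple :=
  (x.1.1 * (y.2 + 1) + y.1.1 * (x.2 + 1), x.1.2 * (y.2 + 1) + y.1.2 * (x.2 + 1),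
   x.2 * y.2 + x.2 + y.2).
Definition mul3 x y : triple :=
  (x.1.1 * y.1.1 + x.1.2 * y.1.2, x.1.1 * y.1.2 + x.1.2 * y.1.1,
   x.2 * y.2 + x.2 + y.2).
Definition opp3 x : triple := (x.1.2, x.1.1, x.2).
(** The numerator turns into a denominator, which is positive, so its sign has to move to the new
    numerator. *)
Definition inv3 x : triple :=
  if `[< x.1.2 < x.1.1 >] then (x.2 + 1, 0, pred_fun M • (x.1.1 ∸ x.1.2))
  else if `[< x.1.1 < x.1.2 >] then (0, x.2 + 1, pred_fun M • (x.1.2 ∸ x.1.1))
  else (0, 0, 0).

(* Locking keeps unification from unfolding the field operations to the quotient. *)
Definition fadd : frac -> frac -> frac := locked (fun p q => mk (add3 (rep p) (rep q))).
Definition fmul : frac -> frac -> frac := locked (fun p q => mk (mul3 (rep p) (rep q))).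
Definition fopp : frac -> frac := locked (fun p => mk (opp3 (rep p))).
Definition finv : frac -> frac := locked (fun p => mk (inv3 (rep p))).

Lemma add3C x y : mk (add3 x y) = mk (add3 y x).
Proof. by apply/mk_eq; rewrite /frac_eq /=; ring. Qed.

Lemma mul3C x y : mk (mul3 x y) = mk (mul3 y x).
Proof. by apply/mk_eq; rewrite /frac_eq /=; ring. Qed.

Lemma add3_eql x x' y : frac_eq x x' -> mk (add3 x y) = mk (add3 x' y).
Proof.
case: x x' y => [[a b] d] [[a' b'] d'] [[a'' b''] d'']; rewrite /frac_eq /= => h.
apply/mk_eq; rewrite /frac_eq /=.
pose k := (a'' + b'') * (d + 1) * (d' + 1) * (d'' + 1).
transitivity ((a * (d' + 1) + b' * (d + 1)) * ((d'' + 1) * (d'' + 1)) + k).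
  by rewrite /k; ring.
by rewrite h /k; ring.
Qed.

Lemma mul3_eql x x' y : frac_eq x x' -> mk (mul3 x y) = mk (mul3 x' y).
Proof.
case: x x' y => [[a b] d] [[a' b'] d'] [[a'' b''] d'']; rewrite /frac_eq /= => h.
apply/mk_eq; rewrite /frac_eq /=.
transitivity ((a * (d' + 1) + b' * (d + 1)) * (a'' * (d'' + 1)) +
  (a' * (d + 1) + b * (d' + 1)) * (b'' * (d'' + 1))); first by ring.
by rewrite h -{2}h; ring.
Qed.

Lemma rep_mk x : frac_eq (rep (mk x)) x.
Proof. by apply/mk_eq; rewrite mk_rep. Qed.

Lemma faddE x y : fadd (mk x) (mk y) = mk (add3 x y).
Proof.
by rewrite /fadd -lock (add3_eql _ (rep_mk x)) add3C (add3_eql _ (rep_mk y)) add3C.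
Qed.

Lemma fmulE x y : fmul (mk x) (mk y) = mk (mul3 x y).
Proof.
by rewrite /fmul -lock (mul3_eql _ (rep_mk x)) mul3C (mul3_eql _ (rep_mk y)) mul3C.
Qed.

Lemma foppE x : fopp (mk x) = mk (opp3 x).
Proof.
rewrite /fopp -lock; apply/mk_eq; move: (rep_mk x); set y := rep _; rewrite /frac_eq /= => h.
by rewrite plusC -h plusC.
Qed.

Definition fzero : frac := mk (0, 0, 0).
Definition fone : frac := mk (1, 0, 0).

Lemma mk_eq0 x : mk x = fzero <-> x.1.1 = x.1.2.
Proof.
rewrite mk_eq /frac_eq /=; set s := x.2.
have -> : x.1.1 * (0 + 1) + 0 * (s + 1) = x.1.1 by ring.
by have -> : 0 * (s + 1) + x.1.2 * (0 + 1) = x.1.2 by ring.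
Qed.

Lemma faddA : associative fadd.
Proof.
elim/frac_ind => x; elim/frac_ind => y; elim/frac_ind => z; rewrite !faddE.
by apply/mk_eq; rewrite /frac_eq /=; ring.
Qed.
Lemma faddC : commutative fadd.
Proof. by elim/frac_ind => x; elim/frac_ind => y; rewrite !faddE add3C. Qed.
Lemma fadd0 : left_id fzero fadd.
Proof. by elim/frac_ind => x; rewrite faddE; apply/mk_eq; rewrite /frac_eq /=; ring. Qed.
Lemma faddN : left_inverse fzero fopp fadd.
Proof. by elim/frac_ind => x; rewrite foppE faddE; apply/mk_eq; rewrite /frac_eq /=; ring. Qed.

HB.instance Definition _ := gen_eqMixin frac.
HB.instance Definition _ := gen_choiceMixin frac.
HB.instance Definition _ := GRing.isZmodule.Build frac faddA faddC fadd0 faddN.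

Lemma fmulA : associative fmul.
Proof.
elim/frac_ind => x; elim/frac_ind => y; elim/frac_ind => z; rewrite !fmulE.
by apply/mk_eq; rewrite /frac_eq /=; ring.
Qed.
Lemma fmulC : commutative fmul.
Proof. by elim/frac_ind => x; elim/frac_ind => y; rewrite !fmulE mul3C. Qed.
Lemma fmul1 : left_id fone fmul.
Proof. by elim/frac_ind => x; rewrite fmulE; apply/mk_eq; rewrite /frac_eq /=; ring. Qed.
Lemma fmulDl : left_distributive fmul fadd.
Proof.
elim/frac_ind => x; elim/frac_ind => y; elim/frac_ind => z; rewrite faddE !fmulE faddE.
by apply/mk_eq; rewrite /frac_eq /=; ring.
Qed.
Lemma fone_neq0 : fone != fzero.
Proof. by apply/eqP => /mk_eq0 /= e; have := lt01 M; rewrite e => /num_ltxx. Qed.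

HB.instance Definition _ :=
  GRing.Zmodule_isComNzRing.Build frac fmulA fmulC fmul1 fmulDl fone_neq0.

Lemma sub_pos (m n : num) : m < n -> n = m + (pred_fun M • (n ∸ m) + 1).
Proof.
move=> h; rewrite {1}(le_subK (or_introl h)); congr plus.
case: (num_cases (n ∸ m)) => [e|[_ //]].
by have := le_subK (or_introl h); rewrite e plus0 => e'; move: h; rewrite e' => /num_ltxx.
Qed.

Lemma fmulV (q : frac) : q != 0%R -> (fmul (finv q) q = fone)%R.
Proof.
rewrite /finv -lock -{1 3}(mk_rep q) fmulE; set x := rep q => /eqP nz.
apply/mk_eq; rewrite /inv3 /frac_eq.
case: asboolP => h; first by rewrite /= {1 3}(sub_pos h); ring.
case: asboolP => k; first by rewrite /= {1 3}(sub_pos k); ring.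
by case: nz; apply/mk_eq0; case: (lt_cases x.1.1 x.1.2).
Qed.

Lemma finv0 : finv 0%R = 0%R.
Proof.
have := mk_rep (0%R : frac) => /mk_eq0; rewrite /finv -lock /inv3 => ->.
by rewrite !asboolF //; exact: num_ltxx.
Qed.

HB.instance Definition _ := GRing.ComNzRing_isField.Build frac fmulV finv0.

Definition fnonneg (q : frac) : Prop := (rep q).1.2 <= (rep q).1.1.

Lemma fnonnegE x : fnonneg (mk x) <-> x.1.2 <= x.1.1.
Proof.
have nn y z : frac_eq y z -> y.1.2 <= y.1.1 -> z.1.2 <= z.1.1.
  rewrite /frac_eq => e /le_subK ey; apply: (@le_times_cancel M _ _ y.2).
  move: e; rewrite ey => e; suff -> : z.1.1 * (y.2 + 1) =
    z.1.2 * (y.2 + 1) + (y.1.1 ∸ y.1.2) * (z.2 + 1) by apply: le_addr.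
  apply: (@plus_cancel M _ _ (y.1.2 * (z.2 + 1))); rewrite -e; ring.
by split; apply: nn; [|apply: frac_eq_sym]; apply: rep_mk.
Qed.

Definition fle (p q : frac) : bool := `[< fnonneg (q - p)%R >].
Definition fnorm (p : frac) : frac := if fle 0%R p then p else (- p)%R.

Lemma fle0 x : fle 0%R (mk x) = `[< x.1.2 <= x.1.1 >].
Proof. by rewrite /fle GRing.subr0; apply: asbool_equiv_eq; exact: fnonnegE. Qed.
Lemma fle_0 x : fle (mk x) 0%R = `[< x.1.1 <= x.1.2 >].
Proof.
rewrite /fle GRing.sub0r; apply: asbool_equiv_eq.
by rewrite [(- mk x)%R]foppE; exact: fnonnegE.
Qed.

Lemma fle0_add (p q : frac) : fle 0%R p -> fle 0%R q -> fle 0%R (p + q)%R.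
Proof.
elim/frac_ind: p => x; elim/frac_ind: q => y; rewrite [(_ + _)%R]faddE !fle0.
move=> /asboolP h /asboolP k; apply/asboolP => /=.
by apply: le_plus2; apply: le_times.
Qed.

Lemma fle0_mul (p q : frac) : fle 0%R p -> fle 0%R q -> fle 0%R (p * q)%R.
Proof.
elim/frac_ind: p => x; elim/frac_ind: q => y; rewrite [(_ * _)%R]fmulE !fle0.
move=> /asboolP /le_subK h /asboolP /le_subK k; apply/asboolP => /=.
move: (_ ∸ _) (_ ∸ _) h k => u v -> ->.
suff -> : (x.1.2 + v) * (y.1.2 + u) + x.1.2 * y.1.2 =
   (x.1.2 + v) * y.1.2 + x.1.2 * (y.1.2 + u) + v * u by apply: le_addr.
ring.
Qed.

Lemma fle0_anti (p : frac) : fle 0%R p -> fle p 0%R -> p = 0%R.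
Proof.
elim/frac_ind: p => x; rewrite fle0 fle_0 => /asboolP h /asboolP k.
by apply/mk_eq0; apply: le_antisym.
Qed.

Lemma fsub_ge0 (p q : frac) : fle 0%R (q - p)%R = fle p q.
Proof. by rewrite /fle GRing.subr0. Qed.

Lemma fle0_total (p : frac) : fle 0%R p || fle p 0%R.
Proof.
elim/frac_ind: p => x; rewrite fle0 fle_0; apply/orP.
by case: (num_le_total x.1.1 x.1.2) => h; [right|left]; apply/asboolP.
Qed.

Lemma fnormN (p : frac) : fnorm (- p)%R = fnorm p.
Proof.
have e q : fle 0%R (- q)%R = fle q 0%R by rewrite -[RHS]fsub_ge0 GRing.sub0r.
rewrite /fnorm GRing.opprK e; case: ifP => h; case: ifP => k //.
  by rewrite (fle0_anti k h) GRing.oppr0.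
by have := fle0_total p; rewrite h k.
Qed.

Lemma fge0_norm (p : frac) : fle 0%R p -> fnorm p = p.
Proof. by rewrite /fnorm => ->. Qed.

HB.instance Definition _ := Num.IntegralDomain_isLeReal.Build frac
  fle0_add fle0_mul fle0_anti fsub_ge0 fle0_total fnormN fge0_norm (fun _ _ => erefl).

(** Carries arithmetic of numbers into an ordered field, where subtraction exists and [lra] and
    [nra] apply. *)
Definition toF (n : num) : frac := mk (n, 0, 0).

End Fractions.
Arguments toF {M} n%_D.

(* Not imported earlier, because it hides the [ring] of Stdlib used on the semiring of numbers. *)
From mathcomp Require Import ring lra.
Import Order.TTheory GRing.Theory Num.Theory.

(** * Numbers inside the field of fractions, and decidable predicates *)

Section Decidable.
Variable M : model.
Local Notation dom := (dom M).
Local Notation num := (dom ty0).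
Local Notation F := (frac M).
Implicit Types (x y m n k : num).

Lemma toF0 : toF 0 = 0%R :> frac M. Proof. by []. Qed.
Lemma toF1 : toF 1 = 1%R :> frac M. Proof. by []. Qed.

Lemma toFD m n : toF (m + n) = (toF m + toF n)%R.
Proof.
rewrite [RHS]faddE; congr mk; rewrite /add3 /=.
by rewrite !(plusC 0) !(plus0, times1, times0).
Qed.

Lemma toFM m n : toF (m * n) = (toF m * toF n)%R.
Proof.
rewrite [RHS]fmulE; congr mk; rewrite /mul3 /=.
by rewrite !(timesC 0) !(plus0, times1, times0).
Qed.

Lemma le_toF m n : (toF m <= toF n)%R <-> m <= n.
Proof.
have -> : (toF m <= toF n)%R = fle (toF m) (toF n) by [].
rewrite /fle [(- _)%R]foppE [(_ + _)%R]faddE; split.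
  by move=> /asboolP /fnonnegE; rewrite /= !(plusC 0) !(plus0, times1) (plusC 0) plus0.
move=> h; apply/asboolP/fnonnegE.
by rewrite /= !(plusC 0) !(plus0, times1) (plusC 0) plus0.
Qed.

Lemma lt_toF m n : (toF m < toF n)%R <-> m < n.
Proof.
rewrite ltNge; split=> [/negP h|h]; last first.
  by apply/negP => /le_toF [/(lt_tr h) /num_ltxx //|e]; move: h; rewrite e => /num_ltxx.
case: (num_le_total n m) => [/le_toF //|[//|e]].
by case: h; rewrite e.
Qed.

Lemma toF_inj : injective (@toF M).
Proof. by move=> m n e; apply: le_antisym; apply/le_toF; rewrite e. Qed.

Lemma toF_ge0 n : (0 <= toF n)%R.
Proof. by rewrite -toF0; apply/le_toF/ge0. Qed.

Lemma lt_SF m n : (toF m < toF n)%R -> (toF m + 1 <= toF n)%R.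
Proof.
move=> /lt_toF h; rewrite (sub_pos h) !toFD toF1.
by have := toF_ge0 (pred_fun M • (n ∸ m)); lra.
Qed.

Lemma monusF m n : (toF n <= toF m)%R -> toF (m ∸ n) = (toF m - toF n)%R.
Proof. by move=> /le_toF /le_subK e; rewrite {2}e toFD; ring. Qed.

Lemma monusF0 m n : (toF m <= toF n)%R -> toF (m ∸ n) = 0%R.
Proof.
move=> h; case: (monus_cases m n) => [e|[_ ->]] //.
have := congr1 (@toF M) e; rewrite toFD; have := toF_ge0 (m ∸ n); lra.
Qed.

Lemma monus_eq0 m n : m ∸ n = 0 <-> m <= n.
Proof.
rewrite -le_toF; split=> [e|/monusF0 /toF_inj //].
have [//|lt] := leP (toF m) (toF n); have := monusF (ltW lt); rewrite e toF0 => {}e; lra.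
Qed.

Lemma plus_eq0 m n : m + n = 0 <-> m = 0 /\ n = 0.
Proof.
split=> [e|[-> ->]]; last by rewrite plus0.
have := congr1 (@toF M) e; rewrite toFD toF0 => h.
have := toF_ge0 m; have := toF_ge0 n => h1 h2.
by split; apply: toF_inj; rewrite toF0; lra.
Qed.

Lemma lt_leS m n : m < n <-> m + 1 <= n.
Proof.
rewrite -lt_toF -le_toF toFD toF1; split=> [/lt_SF //|]; lra.
Qed.

(** Zero sets of definable functions: closed under connectives and bounded quantifiers, and the form
    in which induction, choice and characteristic functions are available. *)
Definition decidable C (P : tuples M C -> Prop) : Prop :=
  exists G : tuples M C -> num, definable C G /\ forall p, P p <-> G p = 0.

Lemma decidable_iff C (P Q : tuples M C -> Prop) :
  (forall p, P p <-> Q p) -> decidable P -> decidable Q.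
Proof. by move=> h [G [dG GP]]; exists G; split=> // p; rewrite -GP h. Qed.

Lemma decidable_le C (G H : tuples M C -> num) :
  definable C G -> definable C H -> decidable (fun p => G p <= H p).
Proof.
move=> dG dH; exists (fun p => G p ∸ H p); split=> [|p]; last by rewrite monus_eq0.
by do 2 (apply: definable_app => //).
Qed.

Lemma decidable_lt C (G H : tuples M C -> num) :
  definable C G -> definable C H -> decidable (fun p => G p < H p).
Proof.
move=> dG dH; apply: (@decidable_iff _ (fun p => G p + 1 <= H p)).
  by move=> p; rewrite lt_leS.
by apply: decidable_le => //; do 2 (apply: definable_app => //).
Qed.

Lemma decidable_and C (P Q : tuples M C -> Prop) :
  decidable P -> decidable Q -> decidable (fun p => P p /\ Q p).
Proof.
move=> [G [dG GP]] [H [dH HQ]]; exists (fun p => G p + H p); split=> [|p].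
  by do 2 (apply: definable_app => //).
by rewrite plus_eq0 GP HQ.
Qed.

Lemma decidable_not C (P : tuples M C -> Prop) : decidable P -> decidable (fun p => ~ P p).
Proof.
move=> [G [dG GP]]; exists (fun p => 1 ∸ G p); split=> [|p].
  by do 2 (apply: definable_app => //).
rewrite GP monus_eq0 -le_toF toF1; split=> [h|h e]; last first.
  by move: h; rewrite e toF0; lra.
have e : toF 0 != toF (G p) by apply/eqP => /toF_inj e; apply: h.
have := @lt_SF 0 (G p); rewrite lt_neqAle e toF_ge0 => /(_ erefl); rewrite toF0; lra.
Qed.

Lemma decidable_eq C (G H : tuples M C -> num) :
  definable C G -> definable C H -> decidable (fun p => G p = H p).
Proof.
move=> dG dH; apply: (@decidable_iff _ (fun p => G p <= H p /\ H p <= G p)).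
  by move=> p; split=> [[]|->]; [exact: le_antisym|split; right].
by apply: decidable_and; apply: decidable_le.
Qed.

Lemma decidable_imp C (P Q : tuples M C -> Prop) :
  decidable P -> decidable Q -> decidable (fun p => P p -> Q p).
Proof.
move=> dP /decidable_not /(decidable_and dP) /decidable_not.
apply: decidable_iff => p; split=> [h k|h [k1 k2]]; [|exact: k2 (h k1)].
by apply: contrapT => k'; exact: (h (conj k k')).
Qed.

Lemma decidable_or C (P Q : tuples M C -> Prop) :
  decidable P -> decidable Q -> decidable (fun p => P p \/ Q p).
Proof.
move=> /decidable_not dP /(decidable_imp dP); apply: decidable_iff => p.
split=> [h|[k k'|k] //]; have [k|/h k] := pselect (P p); by [left|right].
Qed.

Lemma num_ind (P : num -> Prop) : decidable (fun p : tuples M (cons ty0 nil) => P p.2) ->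
  P 0 -> (forall n, P n -> P (n + 1)) -> forall n, P n.
Proof.
move=> [G [dG GP]] P0 PS n.
pose g := Lam (fun x => G (tt, x)).
have gE x : g • x = G (tt, x).
  by apply: LamE; case: dG => h hE; exists h => -[[] y]; exact: hE.
have := @qf_ind M _ (econs g (@no_env M))
  (EqN (App (Var (old new)) (Var new)) (Cst Zero)) Logic.I; rewrite /= => ind.
rewrite (GP (tt, n)) -gE; apply: ind => [|m]; rewrite gE -(GP (tt, _)) //.
by rewrite gE -(GP (tt, _)); exact: PS.
Qed.

Definition sum_fun : dom (ty1 ⇒ ty1) :=
  locked (fn f : ty1 => fn k : ty0 => Rec (fn n : ty0 => fn r : ty0 => r + f • n) 0 k).

Lemma sum_fun0 f : sum_fun • f • 0 = 0.
Proof. by rewrite /sum_fun -lock !LamE // Rec0. Qed.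

Lemma sum_funS f k : sum_fun • f • (k + 1) = sum_fun • f • k + f • k.
Proof. by rewrite /sum_fun -lock !LamE // RecS !LamE. Qed.

Lemma lt_S_cases m n : m < n + 1 -> m < n \/ m = n.
Proof.
move=> /lt_leS /le_toF; rewrite !toFD => h.
by apply/le_toF; lra.
Qed.

Lemma le_lt_tr m n k : m <= n -> n < k -> m < k.
Proof. by move=> [h|->] //; apply: lt_tr. Qed.

Lemma le_trans_num n m k : n <= m -> m <= k -> n <= k.
Proof. by rewrite -!le_toF; exact: le_trans. Qed.

Lemma sum_fun_eq0 f k : sum_fun • f • k = 0 <-> forall i, i < k -> f • i = 0.
Proof.
split=> [h i|h].
  move: k h; apply: num_ind.
  - by apply: decidable_imp; [|apply: decidable_imp; [apply: decidable_lt|]];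
      try apply: decidable_eq.
  - by move=> _ h; have := ge0 i => /(@le_lt_tr _ _ _)/(_ h) /num_ltxx.
  - move=> n IH; rewrite sum_funS => /plus_eq0 [/IH {}IH fn0] /lt_S_cases [/IH //|->] //.
suff : forall n, n <= k -> sum_fun • f • n = 0 by apply; right.
apply: num_ind.
- by apply: decidable_imp; [apply: decidable_le|apply: decidable_eq].
- by rewrite sum_fun0.
- move=> n IH /lt_leS lt; rewrite sum_funS IH ?h ?plus0 //; by left.
Qed.

(** A finite sum of numbers vanishes exactly when all its terms do. *)
Lemma decidable_ball C (K : tuples M C -> num) (P : tuples M C -> num -> Prop) :
  definable C K -> decidable (fun p : tuples M (cons ty0 C) => P p.1 p.2) ->
  decidable (fun p => forall i, i < K p -> P p i).
Proof.
move=> dK [G [dG GP]].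
exists (fun p => sum_fun • Lam (fun i => G (p, i)) • K p); split=> [|p].
  apply: definable_app => //; apply: definable_app; first exact: definable_const.
  by apply: definable_Lam; case: dG => g gE; exists g => -[q x]; exact: gE.
rewrite sum_fun_eq0; have LE i : Lam (fun i => G (p, i)) • i = G (p, i).
  rewrite LamE //; case: dG => g gE; exists (apps (t := ty1) g p) => x; exact: gE.
by split=> h i /h; rewrite LE (GP (p, i)).
Qed.

Lemma monus1_neq0 n : n <> 0 -> 1 ∸ n = 0.
Proof.
move=> nz; case: (num_cases n) => [//|[h _]]; apply/monus_eq0.
by move/lt_leS: h; rewrite plusC plus0.
Qed.

Lemma monus1 n : 1 ∸ n <= 1 /\ (1 ∸ n = 1 <-> n = 0).
Proof.
have [->|nz] := pselect (n = 0); first by rewrite monus0; split=> //; right.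
rewrite (monus1_neq0 nz); split; first exact: ge0.
by split=> // e; have := lt01 M; rewrite -e => /num_ltxx.
Qed.

Lemma decidable_char1 s (P : dom s -> Prop) :
  decidable (fun p : tuples M (cons s nil) => P p.2) ->
  exists f : dom (s ⇒ ty0), forall a, f • a <= 1 /\ (f • a = 1 <-> P a).
Proof.
move=> [G [dG GP]]; exists (Lam (fun a => 1 ∸ G (tt, a))) => a.
rewrite LamE; first by rewrite (GP (tt, a)); exact: monus1.
apply: definable_app => //.
by case: dG => g gE; exists g => -[[] b].
Qed.

Lemma decidable_char2 s t (P : dom s -> dom t -> Prop) :
  decidable (fun p : tuples M (cons t (cons s nil)) => P p.1.2 p.2) ->
  exists f : dom (s ⇒ t ⇒ ty0),
  forall a b, f • a • b <= 1 /\ (f • a • b = 1 <-> P a b).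
Proof.
move=> [G [[g gE] GP]]; exists (Lam (fun a => Lam (fun b => 1 ∸ G (tt, a, b)))) => a b.
have dG : definable (cons t (cons s nil)) (fun p : tuples M _ => 1 ∸ G (tt, p.1.2, p.2)).
  apply: definable_app => //.
  by exists g => -[[[] c] d].
rewrite LamE; last by apply: definable_Lam.
rewrite LamE; first by rewrite (GP (tt, a, b)); exact: monus1.
apply: definable_app => //.
by exists (g • a) => -[[] c]; rewrite gE.
Qed.

(** The element coding the predicate enters as a parameter, so one instance of the choice schema
    serves all decidable predicates. *)
Lemma decidable_choice (P : dom ty1 -> num -> Prop) :
  decidable (fun p : tuples M (cons ty0 (cons ty1 nil)) => P p.1.2 p.2) ->
  (forall a, exists n, P a n) -> exists Y : dom ty2, forall a, P a (Y • a).
Proof.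
move=> [G [[g gE] GP]] h.
have := model_ax (econs g (@no_env M)) (@qf_ac10 _
  (EqN (App (App (Var (old (old new))) (Var (old new))) (Var new)) (Cst Zero)) Logic.I).
rewrite /= => ac; apply: contrapT => nY; apply: ac.
  move=> a; have [n /(GP (tt, a, n))] := h a.
  by rewrite gE /= => e /(_ n).
move=> Y hY; apply: nY; exists Y => a; apply/(GP (tt, a, Y • a)).
by rewrite gE; exact: hY.
Qed.

End Decidable.

Ltac decidability :=
  cbn beta;
  first
    [ refine (decidable_le _ _); definability
    | refine (decidable_lt _ _); definability
    | refine (decidable_eq _ _); definability
    | refine (decidable_and _ _); decidability
    | refine (decidable_not _); decidability
    | refine (decidable_ball _ _); [definability | decidability]
    | refine (decidable_imp _ _); decidability
    | refine (decidable_or _ _); decidability ].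
#[global] Hint Extern 0 (decidable _) => decidability : core.

(** * Codes of pairs and rationals *)

Lemma add_fractions (K : fieldType) (a b c d x y : K) : (x != 0 -> y != 0 ->
  (a * y + b * x - (c * y + d * x)) / (x * y) = (a - c) / x + (b - d) / y)%R.
Proof. by move=> x0 y0; field; rewrite x0 y0. Qed.

Lemma lt_fractions (K : realFieldType) (a b c d x y : K) : (0 < x -> 0 < y ->
  ((a - c) / x < (b - d) / y) = (a * y + d * x < b * x + c * y))%R.
Proof.
move=> x0 y0; rewrite ltr_pdivrMr // mulrAC ltr_pdivlMr // !mulrBl.
by rewrite ltrBlDr addrAC ltrBrDr [(_ + d * x)%R]addrC.
Qed.

Lemma le_fractions (K : realFieldType) (a b c d x y : K) : (0 < x -> 0 < y ->
  ((a - c) / x <= (b - d) / y) = (a * y + d * x <= b * x + c * y))%R.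
Proof. by move=> x0 y0; rewrite !leNgt lt_fractions // addrC [(b * x + _)%R]addrC. Qed.

Section Codes.
Variable M : model.
Local Notation dom := (dom M).
Local Notation num := (dom ty0).
Local Notation F := (frac M).
Implicit Types (a b c d m n k q r : num).

Definition pow2_fun : dom ty1 :=
  locked (fn a : ty0 => Rec (fn n : ty0 => fn r : ty0 => r + r) 1 a).
Definition isqrt_fun : dom ty1 :=
  locked (fn a : ty0 => Rec (fn n : ty0 => fn r : ty0 =>
    r + (1 ∸ ((r + 1) * (r + 1) ∸ (n + 1)))) 0 a).
Definition pair_fun : dom (ty0 ⇒ ty0 ⇒ ty0) :=
  locked (fn a : ty0 => fn b : ty0 => (a + b) * (a + b) + a).
Definition pr1_fun : dom ty1 :=
  locked (fn c : ty0 => c ∸ isqrt_fun • c * (isqrt_fun • c)).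
Definition pr2_fun : dom ty1 :=
  locked (fn c : ty0 => isqrt_fun • c ∸ pr1_fun • c).

Lemma pow2_0 : pow2_fun • 0 = 1.
Proof. by rewrite /pow2_fun -lock LamE // Rec0. Qed.

Lemma pow2_S n : pow2_fun • (n + 1) = pow2_fun • n + pow2_fun • n.
Proof. by rewrite /pow2_fun -lock !LamE // RecS !LamE. Qed.

Lemma isqrt_0 : isqrt_fun • 0 = 0.
Proof. by rewrite /isqrt_fun -lock LamE // Rec0. Qed.

Lemma isqrt_S n : isqrt_fun • (n + 1) = isqrt_fun • n +
  (1 ∸ ((isqrt_fun • n + 1) * (isqrt_fun • n + 1) ∸ (n + 1))).
Proof. by rewrite /isqrt_fun -lock !LamE // RecS !LamE. Qed.

Lemma pair_funE a b : pair_fun • a • b = (a + b) * (a + b) + a.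
Proof. by rewrite /pair_fun -lock !LamE. Qed.

Lemma pr1_funE c : pr1_fun • c = c ∸ isqrt_fun • c * (isqrt_fun • c).
Proof. by rewrite /pr1_fun -lock !LamE. Qed.

Lemma pr2_funE c : pr2_fun • c = isqrt_fun • c ∸ pr1_fun • c.
Proof. by rewrite /pr2_fun -lock !LamE. Qed.

Lemma isqrt_spec n : isqrt_fun • n * (isqrt_fun • n) <= n /\
  n < (isqrt_fun • n + 1) * (isqrt_fun • n + 1).
Proof.
move: n; apply: num_ind => // [|n].
  rewrite isqrt_0 times0 (plusC 0) plus0 times1.
  by split; [right|exact: lt01].
rewrite isqrt_S -!le_toF -!lt_toF; set r := isqrt_fun • n; set s := (r + 1) * (r + 1).
(* Either [n + 1] reaches the square [s] and the root grows by one, or it is still below [s] and the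
   root stays. *)
move=> [h1 h2]; have := lt_SF h2; rewrite le_eqVlt => /orP [/eqP e|lt].
  have {}e : n + 1 = s by apply: toF_inj; rewrite toFD.
  have -> : s ∸ (n + 1) = 0 by apply/monus_eq0; right.
  rewrite monus0 !(toFD, toFM) -[(toF n + _)%R]toFD e !(toFD, toFM) toF1.
  by have := toF_ge0 r; move: (toF r) => x x0; split; nra.
have -> : 1 ∸ (s ∸ (n + 1)) = 0.
  apply/monus_eq0/le_toF; have k : (toF (n + 1) <= toF s)%R by rewrite toFD ltW.
  by rewrite toF1 (monusF k) toFD; have := @lt_SF _ (n + 1) s; rewrite toFD => /(_ lt); lra.
rewrite plus0; split; last by rewrite toFD toF1.
by move: h1; rewrite toFD toF1; lra.
Qed.

Lemma isqrt_unique n r : r * r <= n -> n < (r + 1) * (r + 1) -> isqrt_fun • n = r.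
Proof.
have [] := isqrt_spec n; rewrite -!le_toF -!lt_toF !(toFD, toFM) toF1.
set s := isqrt_fun • n => h1 h2 h3 h4; apply: toF_inj; apply/eqP.
have := toF_ge0 r; have := toF_ge0 s; have := @lt_SF _ r s; have := @lt_SF _ s r.
case: ltgtP => // lt h h'; [have := h isT|have := h' isT]; nra.
Qed.

(** The summand [a] is too small to reach the next square [(a + b + 1)^2]. *)
Lemma isqrt_pair a b : isqrt_fun • (pair_fun • a • b) = a + b.
Proof.
rewrite pair_funE; apply: isqrt_unique; rewrite -?le_toF -?lt_toF !(toFD, toFM) ?toF1;
  have := toF_ge0 a; have := toF_ge0 b; nra.
Qed.

Lemma pr1_pair a b : pr1_fun • (pair_fun • a • b) = a.
Proof.
rewrite pr1_funE isqrt_pair pair_funE; apply: toF_inj; rewrite monusF !(toFD, toFM);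
  last by have := toF_ge0 a; lra.
ring.
Qed.

Lemma pr2_pair a b : pr2_fun • (pair_fun • a • b) = b.
Proof.
rewrite pr2_funE pr1_pair isqrt_pair; apply: toF_inj; rewrite monusF !(toFD, toFM);
  last by have := toF_ge0 b; lra.
ring.
Qed.

Definition pos_fun : dom ty1 := locked (fn q : ty0 => pr1_fun • (pr1_fun • q)).
Definition neg_fun : dom ty1 := locked (fn q : ty0 => pr2_fun • (pr1_fun • q)).
Definition ratio a b d : num := pair_fun • (pair_fun • a • b) • d.

Lemma pos_funE q : pos_fun • q = pr1_fun • (pr1_fun • q).
Proof. by rewrite /pos_fun -lock LamE. Qed.
Lemma neg_funE q : neg_fun • q = pr2_fun • (pr1_fun • q).
Proof. by rewrite /neg_fun -lock LamE. Qed.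

Definition val q : F :=
  ((toF (pos_fun • q) - toF (neg_fun • q)) / (toF (pr2_fun • q) + 1))%R.

Lemma den_gt0 d : (0 < toF d + 1)%R.
Proof. by have := toF_ge0 d; lra. Qed.

Lemma den_neq0 d : (toF d + 1 != 0)%R.
Proof. by rewrite gt_eqF // den_gt0. Qed.

Lemma val_ratio a b d : val (ratio a b d) = ((toF a - toF b) / (toF d + 1))%R.
Proof. by rewrite /val pos_funE neg_funE /ratio !(pr1_pair, pr2_pair). Qed.

Definition add_fun : dom (ty0 ⇒ ty0 ⇒ ty0) := locked (fn q : ty0 => fn r : ty0 =>
  ratio (pos_fun • q * (pr2_fun • r + 1) + pos_fun • r * (pr2_fun • q + 1))
      (neg_fun • q * (pr2_fun • r + 1) + neg_fun • r * (pr2_fun • q + 1))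
      ((pr2_fun • q + 1) * (pr2_fun • r + 1) ∸ 1)).
Definition opp_fun : dom ty1 :=
  locked (fn q : ty0 => ratio (neg_fun • q) (pos_fun • q) (pr2_fun • q)).
Definition abs_fun : dom ty1 := locked (fn q : ty0 =>
  ratio ((pos_fun • q ∸ neg_fun • q) + (neg_fun • q ∸ pos_fun • q)) 0 (pr2_fun • q)).
Definition dist_fun : dom (ty0 ⇒ ty0 ⇒ ty0) :=
  locked (fn q : ty0 => fn r : ty0 => abs_fun • (add_fun • q • (opp_fun • r))).
Definition eps_fun : dom ty1 := locked (fn n : ty0 => ratio 1 0 (pow2_fun • n ∸ 1)).
Definition eps2_fun : dom ty1 := locked (fn n : ty0 => ratio (1 + 1) 0 (pow2_fun • n ∸ 1)).

Definition rlt_code q r : Prop :=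
  pos_fun • q * (pr2_fun • r + 1) + neg_fun • r * (pr2_fun • q + 1) <
  pos_fun • r * (pr2_fun • q + 1) + neg_fun • q * (pr2_fun • r + 1).
Definition rle_code q r : Prop :=
  pos_fun • q * (pr2_fun • r + 1) + neg_fun • r * (pr2_fun • q + 1) <=
  pos_fun • r * (pr2_fun • q + 1) + neg_fun • q * (pr2_fun • r + 1).

Lemma rlt_codeE q r : rlt_code q r <-> (val q < val r)%R.
Proof.
rewrite /rlt_code -lt_toF !(toFD, toFM) toF1 /val.
by rewrite lt_fractions ?den_gt0.
Qed.

Lemma rle_codeE q r : rle_code q r <-> (val q <= val r)%R.
Proof.
rewrite /rle_code -le_toF !(toFD, toFM) toF1 /val.
by rewrite le_fractions ?den_gt0.
Qed.

Lemma val_add q r : val (add_fun • q • r) = (val q + val r)%R.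
Proof.
rewrite /add_fun -lock !LamE // val_ratio monusF !(toFD, toFM) toF1.
  rewrite subrK /val.
  by apply: add_fractions; exact: den_neq0.
have := toF_ge0 (pr2_fun • q); have := toF_ge0 (pr2_fun • r).
move: (toF _) (toF _) => x y x0 y0; nra.
Qed.

Lemma val_opp q : val (opp_fun • q) = (- val q)%R.
Proof. by rewrite /opp_fun -lock !LamE // val_ratio /val -mulNr opprB. Qed.

Lemma val_abs q : val (abs_fun • q) = `|val q|%R.
Proof.
rewrite /abs_fun -lock LamE // val_ratio toFD toF0 subr0 /val.
rewrite normrM normfV [`|_ + 1|%R]gtr0_norm ?den_gt0 //; congr (_ / _)%R.
have [h|/ltW h] := leP (toF (pos_fun • q)) (toF (neg_fun • q)).
  by rewrite (monusF0 h) (monusF h) ler0_norm; [ring|lra].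
by rewrite (monusF0 h) (monusF h) ger0_norm; [ring|lra].
Qed.

Lemma val_dist q r : val (dist_fun • q • r) = `|val q - val r|%R.
Proof. by rewrite /dist_fun -lock !LamE // val_abs val_add val_opp. Qed.

Definition ep n : F := (toF (pow2_fun • n))^-1%R.

Lemma pow2_ge1 n : (1 <= toF (pow2_fun • n))%R.
Proof.
rewrite -toF1; apply/le_toF; move: n; apply: num_ind => // [|n].
  by rewrite pow2_0; right.
by rewrite pow2_S -!le_toF toFD toF1; lra.
Qed.

Lemma pow2_neq0 n : (toF (pow2_fun • n) != 0)%R.
Proof. by have := pow2_ge1 n => h; rewrite gt_eqF //; lra. Qed.

Lemma val_eps n : val (eps_fun • n) = ep n.
Proof.
rewrite /eps_fun -lock LamE // val_ratio monusF toF1 ?pow2_ge1 //.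
by rewrite subrK toF0 subr0 mul1r.
Qed.

Lemma val_eps2 n : val (eps2_fun • n) = (2 * ep n)%R.
Proof.
rewrite /eps2_fun -lock LamE // val_ratio monusF toF1 ?pow2_ge1 //.
by rewrite subrK toF0 subr0 toFD toF1; congr (_ * _)%R.
Qed.

Lemma ep_gt0 n : (0 < ep n)%R.
Proof. by rewrite invr_gt0; have := pow2_ge1 n; lra. Qed.

Lemma epS n : ep (n + 1) = (ep n / 2)%R.
Proof.
rewrite /ep pow2_S toFD; move: (toF _) => x.
have e : (x + x = x * 2)%R by ring.
by rewrite e invfM.
Qed.

Lemma ep_le m n : m <= n -> (ep n <= ep m)%R.
Proof.
move=> /le_subK ->; move: (n ∸ m) => k.
rewrite /ep ler_pV2 ?inE ?unitfE ?pow2_neq0 /=;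
  try by have := pow2_ge1 m; have := pow2_ge1 (m + k); lra.
apply/le_toF; move: k; apply: num_ind => // [|k]; first by rewrite plus0; right.
rewrite -plusA pow2_S -!le_toF toFD; have := pow2_ge1 (m + k); lra.
Qed.

Lemma val0 : val 0 = 0%R.
Proof.
have e : 0 = ratio 0 0 0 by rewrite /ratio !pair_funE !(plus0, times0).
by rewrite {1}e val_ratio toF0 subr0 mul0r.
Qed.

End Codes.
Arguments ep {M} n%_D.
Arguments val {M} q%_D.

(** * The meaning of the defined terms and formulas *)

Section Meaning.
Variable M : model.
Local Notation dom := (dom M).
Local Notation num := (dom ty0).
Implicit Types (n k i : num).

Lemma eval_abs V (e : env M V) s t (a : term (ext s V) t) x :
  eval e (abs a) • x = eval (econs x e) a.
Proof.
elim: a => {t} [t v|t c|r t f IHf b IHb] /=; last by rewrite SigmaE IHf IHb.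
  by case: v => [|u v] /=; rewrite ?SigmaE PiE.
by rewrite PiE.
Qed.

Lemma eval_lam V (e : env M V) s t (f : term (ext s V) s -> term (ext s V) t) :
  eval e (lam s f) = Lam (fun x => eval (econs x e) (f (Var new))).
Proof.
apply: (@model_ext M) => x; rewrite [LHS]eval_abs /Lam; case: pselect => [h|[]].
  by case: (cid h).
by exists (eval e (lam s f)) => y; exact: eval_abs.
Qed.

Lemma eval_Rec V (e : env M V) f a b :
  eval e (App (App (App (Cst Defs.Rec) f) a) b) = Rec (eval e f) (eval e a) (eval e b).
Proof. by []. Qed.

Lemma eval_plus V (e : env M V) a b : eval e (App (App (Cst Plus) a) b) = eval e a + eval e b.
Proof. by []. Qed.

Lemma eval_times V (e : env M V) a b : eval e (App (App (Cst Times) a) b) = eval e a * eval e b.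
Proof. by []. Qed.

Ltac eval_lam := cbn beta; rewrite eval_lam; congr (Lam _); apply: funext => ?.

Lemma eval_predN V (e : env M V) a : eval e (predN a) = pred_fun M • eval e a.
Proof.
rewrite /predN eval_Rec /pred_fun -lock LamE //; congr (Rec _ _ _).
by do 2 eval_lam.
Qed.

Lemma eval_monus V (e : env M V) a b : eval e (Defs.monus a b) = eval e a ∸ eval e b.
Proof.
rewrite /Defs.monus eval_Rec /monus /monus_fun -lock !LamE //; congr (Rec _ _ _).
by do 2 eval_lam; rewrite eval_predN.
Qed.

Lemma eval_pow2 V (e : env M V) a : eval e (pow2 a) = pow2_fun M • eval e a.
Proof.
rewrite /pow2 eval_Rec /pow2_fun -lock LamE //; congr (Rec _ _ _).
by do 2 eval_lam.
Qed.

Lemma eval_isqrt V (e : env M V) a : eval e (isqrt a) = isqrt_fun M • eval e a.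
Proof.
rewrite /isqrt eval_Rec /isqrt_fun -lock LamE //; congr (Rec _ _ _).
by do 2 eval_lam; cbn beta; rewrite eval_plus !eval_monus.
Qed.

Lemma eval_pairN V (e : env M V) a b : eval e (pairN a b) = pair_fun M • eval e a • eval e b.
Proof. by rewrite pair_funE. Qed.

Lemma eval_pr1 V (e : env M V) a : eval e (pr1 a) = pr1_fun M • eval e a.
Proof. by rewrite pr1_funE eval_monus eval_times eval_isqrt. Qed.

Lemma eval_pr2 V (e : env M V) a : eval e (pr2 a) = pr2_fun M • eval e a.
Proof. by rewrite pr2_funE eval_monus eval_isqrt eval_pr1. Qed.

Lemma eval_rpos V (e : env M V) a : eval e (rpos a) = pos_fun M • eval e a.
Proof. by rewrite pos_funE !eval_pr1. Qed.

Lemma eval_rneg V (e : env M V) a : eval e (rneg a) = neg_fun M • eval e a.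
Proof. by rewrite neg_funE eval_pr2 eval_pr1. Qed.

Lemma eval_rat V (e : env M V) a b d : eval e (rat a b d) = ratio (eval e a) (eval e b) (eval e d).
Proof. by rewrite /rat !eval_pairN. Qed.

Lemma eval_radd V (e : env M V) a b : eval e (radd a b) = add_fun M • eval e a • eval e b.
Proof.
rewrite /radd eval_rat /add_fun -lock !LamE // eval_monus !(eval_plus, eval_times).
by rewrite !(eval_rpos, eval_rneg, eval_pr2).
Qed.

Lemma eval_ropp V (e : env M V) a : eval e (ropp a) = opp_fun M • eval e a.
Proof.
by rewrite /ropp eval_rat /opp_fun -lock !LamE // eval_rpos eval_rneg eval_pr2.
Qed.

Lemma eval_rabs V (e : env M V) a : eval e (rabs a) = abs_fun M • eval e a.
Proof.
rewrite /rabs eval_rat /abs_fun -lock !LamE // eval_plus (eval_monus _ (rpos _)) (eval_monus _ (rneg _)).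
by rewrite eval_rpos eval_rneg eval_pr2.
Qed.

Lemma eval_rdist V (e : env M V) a b : eval e (rdist a b) = dist_fun M • eval e a • eval e b.
Proof. by rewrite /rdist eval_rabs eval_radd eval_ropp /dist_fun -lock !LamE. Qed.

Lemma eval_eps V (e : env M V) a : eval e (eps a) = eps_fun M • eval e a.
Proof. by rewrite /eps eval_rat eval_monus eval_pow2 /eps_fun -lock !LamE. Qed.

Lemma eval_eps2 V (e : env M V) a : eval e (eps2 a) = eps2_fun M • eval e a.
Proof. by rewrite /eps2 eval_rat eval_monus eval_pow2 /eps2_fun -lock !LamE. Qed.

(** Such meanings are stated as equalities of propositions, so that they rewrite under
    quantifiers. *)
Lemma holds_rlt V (e : env M V) a b : holds e (rlt a b) =
  (val (eval e a) < val (eval e b))%R :> Prop.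
Proof.
apply: propext; rewrite -rlt_codeE /rlt_code -!eval_rpos -!eval_rneg -!eval_pr2.
exact: iff_refl.
Qed.

Lemma holds_Or V (e : env M V) A B : holds e (Or A B) = (holds e A \/ holds e B).
Proof.
apply: propext; rewrite /=; split=> [h|[h /(_ h) //|h _ //]].
by have [?|/h] := pselect (holds e A); [left|right].
Qed.

Lemma holds_And V (e : env M V) A B : holds e (Defs.And A B) = (holds e A /\ holds e B).
Proof.
apply: propext; rewrite /=; split=> [h|[h k] /(_ h k) //].
by split; apply: contrapT => k; apply: h => a b; apply: k.
Qed.

Lemma holds_all V (e : env M V) s (A : term (ext s V) s -> formula (ext s V)) :
  holds e (all s A) = forall x, holds (econs x e) (A (Var new)).
Proof. by []. Qed.

Lemma holds_ex V (e : env M V) s (A : term (ext s V) s -> formula (ext s V)) :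
  holds e (ex s A) = exists x, holds (econs x e) (A (Var new)).
Proof.
apply: propext; rewrite /=; split=> [h|[x h] /(_ x h) //].
by apply: contrapT => k; apply: h => x h; apply: k; exists x.
Qed.

Lemma holds_rle V (e : env M V) a b : holds e (rle a b) =
  (val (eval e a) <= val (eval e b))%R :> Prop.
Proof.
apply: propext; rewrite -rle_codeE /rle_code /rle holds_Or -!eval_rpos -!eval_rneg -!eval_pr2.
exact: iff_refl.
Qed.

Implicit Types x y : dom ty1.

Definition real x : Prop := forall n i, (`|val (x • n) - val (x • (n + i)%D)| < ep n)%R.
Definition real_eq x y : Prop := forall n, (`|val (x • n) - val (y • n)| <= 2 * ep n)%R.
Definition real_lt x y : Prop := exists n, (val (x • n) + 2 * ep n < val (y • n))%R.
Definition unit_real x : Prop := [/\ real x,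
  (forall n, 0 <= val (x • n) + 2 * ep n)%R & (forall n, val (x • n) <= 1 + 2 * ep n)%R].

Lemma holds_is_real V (e : env M V) a : holds e (is_real a) = real (eval e a).
Proof.
rewrite /is_real holds_all; apply: eq_forall => n; rewrite holds_all; apply: eq_forall => i.
by rewrite holds_rlt eval_rdist eval_eps val_dist val_eps /= /lift !eval_ren.
Qed.

Lemma holds_eqR V (e : env M V) a b : holds e (eqR a b) = real_eq (eval e a) (eval e b).
Proof.
rewrite holds_all; apply: eq_forall => n.
by rewrite holds_rle eval_rdist eval_eps2 val_dist val_eps2 /= /lift !eval_ren.
Qed.

Lemma holds_ltR V (e : env M V) a b : holds e (ltR a b) = real_lt (eval e a) (eval e b).
Proof.
rewrite /ltR holds_ex; apply: eq_exists => n.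
by rewrite holds_rlt eval_radd eval_eps2 val_add val_eps2 /= /lift !eval_ren.
Qed.

Lemma holds_leR V (e : env M V) a b : holds e (leR a b) =
  forall n, (val (eval e a • n) <= val (eval e b • n) + 2 * ep n)%R.
Proof.
rewrite holds_all; apply: eq_forall => n.
by rewrite holds_rle eval_radd eval_eps2 val_add val_eps2 /= /lift !eval_ren.
Qed.

Lemma val_zeroR V (e : env M V) n : val (eval e zeroR • n) = 0%R.
Proof. by rewrite /zeroR [_ • n]eval_abs eval_rat val_ratio toF0 subrr mul0r. Qed.

Lemma val_oneR V (e : env M V) n : val (eval e oneR • n) = 1%R.
Proof. by rewrite /oneR [_ • n]eval_abs eval_rat val_ratio toF0 toF1 subr0 add0r divr1. Qed.

Lemma val_addR V (e : env M V) a b n :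
  val (eval e (addR a b) • n) = (val (eval e a • (n + 1)) + val (eval e b • (n + 1)))%R.
Proof. by rewrite /addR [_ • n]eval_abs eval_radd val_add /= /lift !eval_ren. Qed.

Lemma val_subR V (e : env M V) a b n :
  val (eval e (subR a b) • n) = (val (eval e a • (n + 1)) - val (eval e b • (n + 1)))%R.
Proof.
by rewrite /subR val_addR /oppR [eval e (lam _ _) • _]eval_abs eval_ropp val_opp /= /lift !eval_ren.
Qed.

Lemma val_absR V (e : env M V) a n : val (eval e (absR a) • n) = `|val (eval e a • n)|%R.
Proof. by rewrite /absR [_ • n]eval_abs eval_rabs val_abs /= /lift !eval_ren. Qed.

Lemma holds_in_unit V (e : env M V) a : holds e (in_unit a) = unit_real (eval e a).
Proof.
rewrite /in_unit !holds_And holds_is_real !holds_leR /unit_real.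
under eq_forall => n do rewrite val_zeroR.
under [X in _ /\ _ /\ X]eq_forall => n do rewrite val_oneR.
by apply: propext; split=> [[r [h k]]|[r h k]].
Qed.

End Meaning.

Lemma eq_imply (P P' Q Q' : Prop) : P = P' -> Q = Q' -> (P -> Q) = (P' -> Q').
Proof. by move=> -> ->. Qed.

Lemma holds_Imp (M : structure) V (e : env M V) A B :
  holds e (Imp A B) = (holds e A -> holds e B).
Proof. by []. Qed.

Lemma holds_ltR_zero (M : model) V (e : env M V) a :
  holds e (ltR zeroR a) = exists n, (2 * ep n < val (eval e a • n))%R.
Proof. by rewrite holds_ltR; apply: eq_exists => n; rewrite val_zeroR add0r. Qed.

Lemma holds_ltR_dist (M : model) V (e : env M V) a b c :
  holds e (ltR (absR (subR a b)) c) = exists n,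
    (`|val (eval e a • (n + 1)) - val (eval e b • (n + 1))| + 2 * ep n < val (eval e c • n))%R.
Proof. by rewrite holds_ltR; apply: eq_exists => n; rewrite val_absR val_subR. Qed.

Ltac holds_step :=
  cbn beta;
  first
    [ rewrite holds_is_real | rewrite holds_in_unit | rewrite holds_eqR
    | rewrite holds_ltR_zero | rewrite holds_ltR_dist
    | rewrite holds_all; apply: eq_forall => ?
    | rewrite holds_ex; apply: eq_exists => ?
    | rewrite holds_And; congr and
    | rewrite holds_Or; congr or
    | rewrite holds_Imp; apply: eq_imply ].
Ltac holds_leaf := cbn beta; rewrite /= /lift ?eval_ren; reflexivity.

(** * Meaning of the net theorem and of the covering theorem in a model *)

Section Nets.
Variable M : model.
Local Notation dom := (dom M).
Implicit Types (D B : dom ty2) (R S : dom (ty1 ⇒ ty1 ⇒ ty0)) (l : dom ty1).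
Implicit Types (u v : dom (ty1 ⇒ ty1)).

Definition directed_set D R : Prop :=
  (forall f, D • f <= 1) /\
  (forall f g, R • f • g <= 1) /\
  (exists d, D • d = 1) /\
  (forall d, D • d = 1 -> R • d • d = 1) /\
  (forall d e f, D • d = 1 -> D • e = 1 -> D • f = 1 ->
     R • d • e = 1 -> R • e • f = 1 -> R • d • f = 1) /\
  (forall d e, D • d = 1 -> D • e = 1 ->
     exists f, D • f = 1 /\ R • d • f = 1 /\ R • e • f = 1).

Lemma holds_directed V (e : env M V) a r :
  holds e (directed a r) = directed_set (eval e a) (eval e r).
Proof.
rewrite /directed /directed_set /char1 /char2 /mem /rel /le.
by do ?holds_step; holds_leaf.
Qed.

Definition net_in_unit_interval D R u : Prop :=
  (directed_set D R /\ forall d, D • d = 1 -> real (u • d)) /\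
  forall d, D • d = 1 -> unit_real (u • d).

Lemma holds_net_in_unit V (e : env M V) a r x :
  holds e (net_in_unit a r x) = net_in_unit_interval (eval e a) (eval e r) (eval e x).
Proof.
rewrite /net_in_unit /net /net_in_unit_interval 2!holds_And holds_directed /mem.
by congr and; [congr and|]; do ?holds_step; holds_leaf.
Qed.

Definition net_converges D R u l : Prop :=
  forall e, real e -> (exists n, 2 * ep n < val (e • n))%R ->
  exists d0, D • d0 = 1 /\ forall d, D • d = 1 -> R • d0 • d = 1 ->
  exists n, (`|val (u • d • (n + 1)) - val (l • (n + 1))| + 2 * ep n < val (e • n))%R.

Lemma holds_converges V (e : env M V) a r x y :
  holds e (converges a r x y) =
  net_converges (eval e a) (eval e r) (eval e x) (eval e y).
Proof.
rewrite /converges /net_converges /mem /rel.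
by do ?holds_step; holds_leaf.
Qed.

Definition subnet_of B S v D R u : Prop :=
  (directed_set B S /\ forall b, B • b = 1 -> real (v • b)) /\
  exists p : dom (ty1 ⇒ ty1),
    (forall b, B • b = 1 -> D • (p • b) = 1 /\ real_eq (v • b) (u • (p • b))) /\
    (forall d, D • d = 1 -> exists b0, B • b0 = 1 /\
       forall b, B • b = 1 -> S • b0 • b = 1 -> R • d • (p • b) = 1).

Lemma holds_subnet V (e : env M V) b q y a r x : holds e (subnet b q y a r x) =
  subnet_of (eval e b) (eval e q) (eval e y) (eval e a) (eval e r) (eval e x).
Proof.
rewrite /subnet /net /subnet_of 2!holds_And holds_directed /mem /rel.
by congr and; [congr and|]; do ?holds_step; holds_leaf.
Qed.

Lemma holds_BW_net : holds (@no_env M) BW_net ->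
  forall D R u, net_in_unit_interval D R u ->
  exists B S v, subnet_of B S v D R u /\ exists l, real l /\ net_converges B S v l.
Proof.
rewrite /BW_net holds_all => h D R u net; move: (h D).
rewrite holds_all => /(_ R); rewrite holds_all => /(_ u).
rewrite holds_Imp holds_net_in_unit => /(_ net).
rewrite holds_ex => -[B]; rewrite holds_ex => -[S]; rewrite holds_ex => -[v].
rewrite holds_And holds_subnet holds_ex => -[sub [l]].
rewrite holds_And holds_is_real holds_converges => hl.
by exists B, S, v; split; last exists l.
Qed.

(** The shifted index [n + 1] is the one built into [addR] and [subR]. *)
Definition finite_cover (P : dom (ty1 ⇒ ty1)) : Prop := exists k (y : dom (ty0 ⇒ ty1)),
  (forall i, i < k -> unit_real (y • i)) /\
  (forall x, unit_real x -> exists i, [/\ i < k,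
    exists n, (val (y • i • (n + 1)) - val (P • (y • i) • (n + 1)) + 2 * ep n <
               val (x • n))%R &
    exists n, (val (x • n) + 2 * ep n <
               val (y • i • (n + 1)) + val (P • (y • i) • (n + 1)))%R]).

Lemma holds_HBU :
  (forall P : dom (ty1 ⇒ ty1),
    (forall x, real x -> real (P • x)) ->
    (forall x y, real x -> real y -> real_eq x y -> real_eq (P • x) (P • y)) ->
    (forall x, real x -> exists n, (2 * ep n < val (P • x • n))%R) ->
    finite_cover P) ->
  holds (@no_env M) HBU.
Proof.
move=> h; rewrite /HBU holds_all => P.
rewrite holds_Imp /positive_function /real_function 2!holds_And => -[[h1 h2] h3].
have [x|x y|x|k [y [hy hcov]]] := h P.
- by move: h1; rewrite holds_all => /(_ x); rewrite holds_Imp !holds_is_real.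
- by move: h2; rewrite holds_all => /(_ x); rewrite holds_all => /(_ y);
    rewrite 3!holds_Imp !holds_is_real !holds_eqR.
- by move: h3; rewrite holds_all => /(_ x); rewrite holds_Imp holds_is_real holds_ltR_zero.
rewrite holds_ex; exists k; rewrite holds_ex; exists y; rewrite holds_And; split.
  by rewrite holds_all => i; rewrite holds_Imp holds_in_unit => /hy.
rewrite holds_all => x; rewrite holds_Imp holds_in_unit => /hcov [i [ik lo hi]].
rewrite holds_ex; exists i; rewrite 2!holds_And !holds_ltR; split; first exact: ik.
split; [case: lo|case: hi] => n hn; exists n.
  by rewrite val_subR.
by rewrite val_addR.
Qed.

End Nets.

(** * Real numbers of a model *)

Lemma decidable_val_lt (M : model) C (G H : tuples M C -> dom M ty0) :
  definable C G -> definable C H -> decidable (fun p => (val (G p) < val (H p))%R).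
Proof.
move=> dG dH; apply: (@decidable_iff M C (fun p => rlt_code (G p) (H p))).
  by move=> p; rewrite rlt_codeE.
by apply: decidable_lt; repeat (apply: definable_app => //).
Qed.

Lemma decidable_val_le (M : model) C (G H : tuples M C -> dom M ty0) :
  definable C G -> definable C H -> decidable (fun p => (val (G p) <= val (H p))%R).
Proof.
move=> dG dH; apply: (@decidable_iff M C (fun p => rle_code (G p) (H p))).
  by move=> p; rewrite rle_codeE.
by apply: decidable_le; repeat (apply: definable_app => //).
Qed.

Ltac decidability ::=
  cbn beta;
  first
    [ refine (decidable_val_le _ _); definability
    | refine (decidable_val_lt _ _); definability
    | refine (decidable_le _ _); definability
    | refine (decidable_lt _ _); definability
    | refine (decidable_eq _ _); definability
    | refine (decidable_and _ _); decidability
    | refine (decidable_not _); decidability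
    | refine (decidable_ball _ _); [definability | decidability]
    | refine (decidable_imp _ _); decidability
    | refine (decidable_or _ _); decidability ].

(** Lets every number code a rational of [0, 1] and moves any real into [0, 1]. It does not increase
    distances, so rates of convergence survive. *)
Definition clamp (K : realFieldType) (x : K) : K :=
  (if x <= 0 then 0 else if 1 <= x then 1 else x)%R.

Section Clamp.
Variable K : realFieldType.
Implicit Types x y d : K.
Local Open Scope ring_scope.

Lemma clamp_unit x : 0 <= clamp x <= 1.
Proof. by rewrite /clamp; case: (leP x 0); case: (leP 1 x); lra. Qed.

Lemma clamp_id x : 0 <= x <= 1 -> clamp x = x.
Proof. by rewrite /clamp; case: (leP x 0); case: (leP 1 x); lra. Qed.

Lemma clamp_dist x y d : `|x - y| < d -> `|clamp x - clamp y| < d.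
Proof.
rewrite !ltr_norml /clamp.
by case: (leP x 0); case: (leP 1 x); case: (leP y 0); case: (leP 1 y); lra.
Qed.

Lemma clamp_near x d : 0 <= d -> 0 <= x + d -> x <= 1 + d -> `|clamp x - x| <= d.
Proof.
rewrite ler_norml /clamp; case: (leP x 0); case: (leP 1 x); lra.
Qed.

Lemma norm_bounds x : - `|x| <= x <= `|x|.
Proof. by rewrite -ler_norml. Qed.

End Clamp.

Section Reals.
Variable M : model.
Local Notation dom := (dom M).
Local Notation num := (dom ty0).
Local Notation F := (frac M).
Implicit Types (n m k i q : num) (x y l : dom ty1).

(** Here [u] is the positive part of the numerator, and [u ∸ (u ∸ v)] is the minimum of [u] and
    [v]. *)
Definition clamp_fun : dom ty1 := locked (fn q : ty0 =>
  let u := pos_fun M • q ∸ neg_fun M • q in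
  ratio (u ∸ (u ∸ (pr2_fun M • q + 1))) 0 (pr2_fun M • q)).

Lemma val_clamp q : val (clamp_fun • q) = clamp (val q).
Proof.
rewrite /clamp_fun -lock LamE // val_ratio toF0 subr0 /clamp /val.
set a := pos_fun M • q; set b := neg_fun M • q; set d := pr2_fun M • q.
have d0 := den_gt0 d; have dn := den_neq0 d.
rewrite ler_pdivrMr // mul0r subr_le0 ler_pdivlMr // mul1r.
have [ab|/ltW ba] := leP (toF a) (toF b).
  have -> : a ∸ b = 0 by apply/monus_eq0/le_toF.
  rewrite (_ : 0 ∸ _ = 0) ?toF0 ?mul0r //; apply/monus_eq0/ge0.
have e := monusF ba; have [h|/ltW h] := leP (toF d + 1)%R (toF a - toF b)%R.
  have h' : (toF (d + 1) <= toF (a ∸ b))%R by rewrite e toFD.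
  have hu := monusF h'; rewrite monusF hu toFD toF1; last by lra.
  by rewrite subKr divff.
have h' : (toF (a ∸ b) <= toF (d + 1))%R by rewrite e toFD.
by rewrite monusF (monusF0 h') ?toF_ge0 // subr0 e.
Qed.

Lemma real_dist x n m : real x -> (`|val (x • n) - val (x • m)| < ep n + ep m)%R.
Proof.
move=> rx; have := ep_gt0 n; have := ep_gt0 m.
case: (num_le_total n m) => /le_subK ->; [have := rx n (m ∸ n)|have := rx m (n ∸ m)].
  by move: (val _) (val _) => a b; rewrite !ltr_norml; lra.
by move: (val _) (val _) => a b; rewrite !ltr_norml; lra.
Qed.

Definition const_real q : dom ty1 := Lam (fun n => q).

Lemma const_realE q n : const_real q • n = q.
Proof. by rewrite LamE. Qed.

Lemma real_const q : real (const_real q).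
Proof. by move=> n i; rewrite !const_realE subrr normr0 ep_gt0. Qed.

Lemma unit_const q : (0 <= val q <= 1)%R -> unit_real (const_real q).
Proof.
move=> h; split=> [|n|n]; first exact: real_const.
  by rewrite const_realE; have := ep_gt0 n; lra.
by rewrite const_realE; have := ep_gt0 n; lra.
Qed.

Definition clamp_real x : dom ty1 := Lam (fun n => clamp_fun • (x • n)).

Lemma clamp_realE x n : clamp_real x • n = clamp_fun • (x • n).
Proof. by rewrite LamE. Qed.

Lemma real_clamp x : real x -> real (clamp_real x).
Proof. by move=> rx n i; rewrite !clamp_realE !val_clamp; exact: clamp_dist. Qed.

Lemma unit_clamp x : real (clamp_real x) -> unit_real (clamp_real x).
Proof.
move=> rx; split=> // n; rewrite !clamp_realE val_clamp;
  by have := clamp_unit (val (x • n)); have := ep_gt0 n; lra.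
Qed.

Lemma unit_near_clamp x n : unit_real x ->
  (`|clamp (val (x • n)) - val (x • n)| <= 2 * ep n)%R.
Proof. by move=> [_ h k]; apply: clamp_near => //; have := ep_gt0 n; lra. Qed.

End Reals.

(** * Covers from convergent sub-nets *)

Section Cover.
Variables (M : model) (P : dom M (ty1 ⇒ ty1)).
Local Notation dom := (dom M).
Local Notation num := (dom ty0).
Local Notation F := (frac M).
Implicit Types (n m k i j q : num) (x y l d e f : dom ty1).

Hypothesis bw : holds (@no_env M) BW_net.
Hypothesis P_real : forall x, real x -> real (P • x).

(* The code [q] is, up to [4 * 2^-k], not covered by the [i]-th ball. *)
Definition uncovered (Y : dom (ty0 ⇒ ty1)) k q : Prop := forall i, i < k ->
  (val (P • (Y • i) • (k + 1)) <=
   `|val (clamp_fun M • q) - val (Y • i • (k + 1))| + 4 * ep k)%R.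

(** Otherwise the first [k] balls cover: the approximation [x • k] of a point is not uncovered. Of
    the margin [4 * ep k], one half pays for clamping [x • k] and the other is the gap that strict
    inequality of reals requires at index [k]. The single number [k] is both length and
    precision. *)
Lemma uncovered_exists Y k : ~ finite_cover P ->
  (forall i, unit_real (Y • i)) -> exists q, uncovered Y k q.
Proof.
move=> nc uY; apply: contrapT => nq; apply: nc; exists k, Y; split=> [//|x ux].
apply: contrapT => nx; apply: nq; exists (x • k) => i ik; rewrite leNgt; apply/negP => lt.
have := norm_bounds (clamp (val (x • k)) - val (Y • i • (k + 1)))%R.
have := unit_near_clamp k ux; move: lt; rewrite val_clamp ler_norml.
move=> h1 h2 h3; have e0 := ep_gt0 k; apply: nx; exists i.
by split=> //; exists k; lra.
Qed.

Lemma decidable_uncovered (K : dom ty2) (Y : dom (ty1 ⇒ ty0 ⇒ ty1)) :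
  decidable (fun p : tuples M (cons ty0 (cons ty1 nil)) =>
    uncovered (Y • p.1.2) (K • p.1.2) p.2).
Proof.
pose Q (p : tuples M (cons ty0 (cons ty1 nil))) : Prop := forall i, i < K • p.1.2 ->
  (val (P • (Y • p.1.2 • i) • (K • p.1.2 + 1)) <=
   val (add_fun M • (dist_fun M • (clamp_fun M • p.2) • (Y • p.1.2 • i • (K • p.1.2 + 1))) •
     (add_fun M • (eps2_fun M • (K • p.1.2)) • (eps2_fun M • (K • p.1.2)))))%R.
apply: (@decidable_iff M _ Q); last by rewrite /Q.
move=> p; rewrite /Q /uncovered; set k := K • _.
have e4 : (2 * ep k + 2 * ep k = 4 * ep k)%R by ring.
by split=> h i ik; move: (h i ik); rewrite !val_add val_dist !val_eps2 e4.
Qed.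

(** Finite sequences are read off from arbitrary functions, so the whole of Baire space can be the
    index set. *)
Definition all_indices : dom ty2 := Lam (fun _ => 1).

Lemma mem_all_indices d : all_indices • d = 1.
Proof. by rewrite LamE. Qed.

(** * The net of uncovered rationals for sequences [Y • d] of length [K • d] *)

Section Net.
Variables (K : dom ty2) (Y : dom (ty1 ⇒ ty0 ⇒ ty1)) (R : dom ty1 -> dom ty1 -> Prop).
Hypotheses (R_dec : decidable (fun p : tuples M (cons ty1 (cons ty1 nil)) => R p.1.2 p.2))
  (R_refl : forall d, R d d)
  (R_trans : forall d e f, R d e -> R e f -> R d f)
  (R_dir : forall d e, exists f, R d f /\ R e f)
  (Y_unit : forall d i, unit_real (Y • d • i)).

(** Of the convergent sub-net only a cluster point is kept: a common upper bound of the index for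
    cofinality and the index for convergence maps to [e]. The term [2 * ep (n + 1)] allows for
    sub-net values that equal those of the net only as reals. *)
Lemma uncovered_net : ~ finite_cover P ->
  exists (X : dom ty2) l, [/\ real l, forall d, uncovered (Y • d) (K • d) (X • d) &
    forall d m, exists2 e, R d e & exists n,
      (`|val (clamp_fun M • (X • e)) - val (l • (n + 1))| + 2 * ep n < 2 * ep (n + 1) + ep m)%R].
Proof.
move=> nc.
have [X hX] := decidable_choice (decidable_uncovered K Y)
  (fun d => uncovered_exists (K • d) nc (Y_unit d)).
have [S S_char] := decidable_char2 R_dec.
have hS d e : S • d • e = 1 <-> R d e by case: (S_char d e).
pose u : dom (ty1 ⇒ ty1) := Lam (fun d => Lam (fun n => clamp_fun M • (X • d))).
have uE d n : u • d • n = clamp_fun M • (X • d) by rewrite !LamE.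
have u_unit d : unit_real (u • d).
  have -> : u • d = const_real (clamp_fun M • (X • d)).
    by apply: (@model_ext M) => n; rewrite uE const_realE.
  by apply: unit_const; rewrite val_clamp clamp_unit.
have netu : net_in_unit_interval all_indices S u.
  split=> [|d _ //]; split=> [|d _]; last by case: (u_unit d).
  split=> [f|]; first by rewrite mem_all_indices; right.
  split=> [f g|]; first by have [] := S_char f g.
  split; first by exists (const_real 0); exact: mem_all_indices.
  split=> [d _|]; first by apply/hS.
  split=> [d e f _ _ _ /hS h1 /hS h2|d e _ _]; first by apply/hS; exact: R_trans h2.
  have [f [h1 h2]] := R_dir d e; exists f; rewrite mem_all_indices.
  by split=> //; split; apply/hS.
have [B [T [v [[[Bdir v_real] [p [pE p_cof]]] [l [l_real cv]]]]]] := holds_BW_net bw netu.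
exists X, l; split=> // d m.
have [b0 [Bb0 hb0]] := p_cof d (mem_all_indices d).
have em_real : real (const_real (eps_fun M • m)) by apply: real_const.
have [|b1 [Bb1 hb1]] := cv _ em_real.
  (* Positivity of the constant real: [2 * ep (m + 2)] is half of [ep m]. *)
  exists (m + 1 + 1); rewrite const_realE val_eps !epS; have := ep_gt0 m; lra.
have [_ [_ [_ [_ [_ Bdir2]]]]] := Bdir.
have [b [Bb [b0b b1b]]] := Bdir2 _ _ Bb0 Bb1.
exists (p • b); first by apply/hS; exact: hb0.
have [n hn] := hb1 b Bb b1b; exists n; move: hn; rewrite const_realE val_eps.
have [_ /(_ (n + 1))] := pE b Bb; rewrite uE.
set a := val _; set c := val _; set z := val _ => h1.
have -> : (c - z = (a - z) - (a - c))%R by ring.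
have := ler_normB (a - z)%R (a - c)%R; lra.
Qed.

(** Without a finite cover, the clamped cluster point lies well inside the ball of some [y] that
    eventually occurs. At a late index the rational close to this point is inside that ball, yet it
    was chosen uncovered by it. *)
Lemma finite_cover_of_net :
  (forall l, unit_real l -> exists y m, [/\ real y,
     (`|val (l • m) - val (y • m)| + 4 * ep m < val (P • y • m))%R &
     forall N, exists d, forall e, R d e -> N <= K • e /\
       exists i, i < K • e /\ Y • e • i = y]) ->
  finite_cover P.
Proof.
move=> hcov; apply: contrapT => nc.
have [X [l [l_real hX hl]]] := uncovered_net nc.
(* The hypothesis speaks of points of [0, 1], whereas the limit is only known to be a real. *)
have rl' := real_clamp l_real.
have [y [m [y_real ycov yN]]] := hcov _ (unit_clamp rl').
(* The final estimate yields [ep m / 2 < 6 * ep k], which is absurd once [ep k] is at most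
   [ep m / 16]. *)
have [d hd] := yN (m + 1 + 1 + 1 + 1).
have [e de [n hn]] := hl d (m + 1).
have [mK [i [iK Yi]]] := hd e de.
have := hX e i iK; rewrite Yi; move: mK; set k := K • e => mK.
have := ep_le mK; rewrite !epS => ek.
have h1 := real_dist (k + 1) m (P_real y_real).
have h2 := real_dist (k + 1) m y_real.
have h3 := real_dist (k + 1) m rl'.
have h4 := real_dist (n + 1) (k + 1) rl'.
have hc := hn; set r := val (clamp_fun M • (X • e)) in hn.
have r_unit : (0 <= r <= 1)%R by rewrite /r val_clamp clamp_unit.
(* Clamping fixes [r], so it brings the limit no further away from it. *)
have {}hc : (`|r - val (clamp_real l • (n + 1))| < ep m / 2 - ep n)%R.
  rewrite -(clamp_id r_unit) clamp_realE val_clamp; apply: clamp_dist.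
  by move: hn; rewrite !epS; lra.
rewrite -/r => h5; have em := ep_gt0 m; have en := ep_gt0 n; have ek0 := ep_gt0 k.
have [h6 h7] := (norm_bounds (val (clamp_real l • m) - val (y • m))%R, ycov).
(* The path goes from [r] to the limit at [n + 1], then at [k + 1], then at [m], on to [y] at [m],
   and to [y] at [k + 1]. *)
have : (`|r - val (y • (k + 1))| <
    `|val (clamp_real l • m) - val (y • m)| + ep m * 5 / 2 + ep k * 3 / 2)%R.
  move: h2 h3 h4 hc h6; rewrite !epS !ltr_norml.
  lra.
move: h1; rewrite !epS ltr_norml => h1 h8; lra.
Qed.

End Net.
End Cover.

(** * A functional searching for zeros *)

Section Search.
Variable M : model.
Local Notation dom := (dom M).
Local Notation num := (dom ty0).
Implicit Types (n m k i j c : num) (f l : dom ty1).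

(** Choice over functions is applied to constant functions, a number [m] being read as the value at
    0. *)
Lemma num_choice (Q : num -> num -> Prop) :
  decidable (fun p : tuples M (cons ty0 (cons ty0 nil)) => Q p.1.2 p.2) ->
  (forall m, exists n, Q m n) -> exists g : dom ty1, forall m, Q m (g • m).
Proof.
move=> [G [[g gE] GQ]] h.
have [|a|Y hY] := @decidable_choice M (fun a n => Q (a • 0) n).
- exists (fun p => G (tt, p.1.2 • 0, p.2)); split=> [|p]; last exact: (GQ (tt, p.1.2 • 0, p.2)).
  have [h1 h1E] : definable (cons ty0 (cons ty1 nil))
    (fun p : tuples M _ => g • (p.1.2 • 0) • p.2) by [].
  by exists h1 => p; rewrite -h1E gE.
- exact: h.
exists (Lam (fun m => Y • const_real m)) => m.
rewrite LamE; first by have := hY (const_real m); rewrite const_realE.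
by rewrite /const_real.
Qed.

(* [search f n] is the least zero of [f] below [n], or [n] if there is none. *)
Definition search : dom (ty1 ⇒ ty1) := locked (fn f : ty1 => fn n : ty0 =>
  Rec (fn k : ty0 => fn r : ty0 => r + (1 ∸ (1 ∸ f • r))) 0 n).

Lemma search0 f : search • f • 0 = 0.
Proof. by rewrite /search -lock !LamE // Rec0. Qed.

Lemma searchS f n : search • f • (n + 1) =
  search • f • n + (1 ∸ (1 ∸ f • (search • f • n))).
Proof. by rewrite /search -lock !LamE // RecS !LamE. Qed.

Lemma searchS_zero f n : f • (search • f • n) = 0 -> search • f • (n + 1) = search • f • n.
Proof.
move=> e; rewrite searchS e monus0 (_ : 1 ∸ 1 = 0) ?plus0 //.
by apply/monus_eq0; right.
Qed.

Lemma searchS_nonzero f n : f • (search • f • n) <> 0 ->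
  search • f • (n + 1) = search • f • n + 1.
Proof. by move=> nz; rewrite searchS (monus1_neq0 nz) monus0. Qed.

Lemma search_stop f n : f • (search • f • n) = 0 \/ search • f • n = n.
Proof.
move: n; apply: num_ind => // [|n IH]; first by right; exact: search0.
have [z|nz] := pselect (f • (search • f • n) = 0); first by left; rewrite searchS_zero.
by right; rewrite searchS_nonzero //; case: IH => [//|->].
Qed.

Lemma search_stable f n i : f • (search • f • n) = 0 -> search • f • (n + i) = search • f • n.
Proof.
move=> z; move: i; apply: num_ind => // [|i IH]; first by rewrite plus0.
by rewrite -plusA searchS_zero IH.
Qed.

Lemma search_mono f n i : search • f • n <= search • f • (n + i).
Proof.
move: i; apply: num_ind => // [|i]; first by rewrite plus0; right.
rewrite -plusA searchS; set s := search • f • (n + i); set t := _ ∸ _ => h.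
have := le_plus2 h (ge0 t); by rewrite plus0.
Qed.

Lemma search_least f n j : j < search • f • n -> f • j <> 0.
Proof.
move: n; apply: num_ind => // [|n IH].
  by rewrite search0; case: (ge0 j) => [h /(lt_tr h) /num_ltxx|<- /num_ltxx].
have [z|nz] := pselect (f • (search • f • n) = 0); first by rewrite searchS_zero.
by rewrite searchS_nonzero // => /lt_S_cases [/IH //|->].
Qed.

End Search.

(** * The case of a discontinuous function *)

Section Grilliot.
Variables (M : model) (P : dom M (ty1 ⇒ ty1)) (l : dom M ty1).
Local Notation dom := (dom M).
Local Notation num := (dom ty0).
Implicit Types (n m k i j c : num) (f x y : dom ty1).
Hypotheses (P_real : forall x, real x -> real (P • x))
  (P_ext : forall x y, real x -> real y -> real_eq x y -> real_eq (P • x) (P • y))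
  (P_pos : forall x, real x -> exists n, (2 * ep n < val (P • x • n))%R)
  (l_unit : unit_real l)
  (small : forall j m, (val (P • const_real (clamp_fun M • j) • m) <=
     `|val (l • m) - val (clamp_fun M • j)| + 4 * ep m)%R).

(* [switch c • f] follows [l] up to the least zero [i] of [f], and then stays at its [(i + c)]-th
   approximation; if [f] has no zero it is [l]. *)
Definition switch c : dom (ty1 ⇒ ty1) := Lam (fun f => Lam (fun n =>
  clamp_fun M • (l • (search M • f • n + c * (1 ∸ f • (search M • f • n)))))).

Lemma switchE_nonzero c f n : f • (search M • f • n) <> 0 ->
  search M • f • n = n /\ switch c • f • n = clamp_fun M • (l • n).
Proof.
move=> nz; have e : search M • f • n = n by case: (search_stop f n) => [/nz|].
by split=> //; rewrite !LamE // (monus1_neq0 nz) times0 plus0 e.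
Qed.

Lemma switchE_zero c f n : f • (search M • f • n) = 0 ->
  switch c • f • n = clamp_fun M • (l • (search M • f • n + c)).
Proof. by move=> z; rewrite !LamE // z monus0 times1. Qed.

Lemma clamp_step n m : n <= m ->
  (`|val (clamp_fun M • (l • n)) - val (clamp_fun M • (l • m))| < ep n)%R.
Proof.
by move=> /le_subK ->; rewrite !val_clamp; apply: clamp_dist; case: l_unit => h _ _; apply: h.
Qed.

Lemma switch_real c f : real (switch c • f).
Proof.
move=> n i; have [z|nz] := pselect (f • (search M • f • n) = 0).
  have e := search_stable i z.
  by rewrite (switchE_zero _ z) switchE_zero e // subrr normr0 ep_gt0.
have [en ->] := switchE_nonzero c nz.
have ge : n <= search M • f • (n + i) by rewrite -{1}en; exact: search_mono.
have [z|nz'] := pselect (f • (search M • f • (n + i)) = 0).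
  by rewrite switchE_zero //; apply: clamp_step; apply: le_trans_num ge (le_addr _ _).
have [_ ->] := switchE_nonzero c nz'; apply: clamp_step; exact: le_addr.
Qed.

Lemma switch_nonzero c f : (forall n, f • n <> 0) -> switch c • f = clamp_real l.
Proof.
move=> nz; apply: (@model_ext M) => n; rewrite clamp_realE.
by have [_ ->] := switchE_nonzero c (nz (search M • f • n)).
Qed.

(** Equality holds only as reals, since below the least zero the approximations still follow [l].
    Extensionality of [P] on reals will carry it over to the values of [P]. *)
Lemma switch_zero c f j : f • j = 0 -> exists i, c <= i /\
  real_eq (switch c • f) (const_real (clamp_fun M • (l • i))).
Proof.
move=> fj; set s := search M • f • (j + 1).
have fs : f • s = 0.
  case: (search_stop f (j + 1)) => // e.
  have : j < search M • f • (j + 1) by rewrite e; exact: lt_S.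
  by move=> /search_least.
exists (s + c); split; first by rewrite plusC; exact: le_addr.
move=> n; rewrite const_realE; have e0 := ep_gt0 n.
have [z|nz] := pselect (f • (search M • f • n) = 0).
  rewrite switchE_zero //; suff -> : search M • f • n = s by rewrite subrr normr0; lra.
  case: (num_le_total n (j + 1)) => /le_subK e.
    by rewrite /s e search_stable.
  by rewrite e search_stable.
have [en ->] := switchE_nonzero c nz.
have h : n <= s.
  case: (num_le_total n (j + 1)) => /le_subK e; first by rewrite -{1}en /s e; exact: search_mono.
  by case: nz; rewrite e search_stable.
apply: ltW; apply: lt_le_trans (clamp_step (le_trans_num h (le_addr s c))) _; lra.
Qed.

Lemma small_dist i m :
  (`|val (l • m) - clamp (val (l • i))| < ep i + 3 * ep m)%R.
Proof.
have [h _ _] := l_unit; have := clamp_dist (real_dist m i h).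
have := unit_near_clamp m l_unit; rewrite ler_norml !ltr_norml; lra.
Qed.

(** At [switch c • f] the function [P] takes its positive value at [l] if [f] has no zero, and
    otherwise its value at a rational near [l], which [small] makes tiny. One approximation of this
    value separates the cases. *)
Lemma zero_test : exists E : dom ty2, forall f, E • f = 0 <-> exists n, f • n = 0.
Proof.
have rl : real (clamp_real l) by apply: real_clamp; case: l_unit.
have [n0 hn0] := P_pos rl.
(* If [f] has a zero, the value at [m] is below [ep c + 9 * ep m], that is 13/32 of [ep n0]; if not,
   it exceeds 31/32 of [ep n0]. The threshold [ep (n0 + 1)] is one half of [ep n0]. *)
pose m := n0 + 1 + 1 + 1 + 1 + 1; pose c := n0 + 1 + 1 + 1.
have [//|E hE] := @decidable_char1 M ty1
  (fun f => (val (eps_fun M • (n0 + 1)) < val (P • (switch c • f) • m))%R).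
have test f : E • f = 1 <-> forall n, f • n <> 0.
  case: (hE f) => _ ->; rewrite val_eps; split=> [h j fj|nz].
    have [i [ci ei]] := switch_zero c fj.
    have h1 := P_ext (switch_real c f) (real_const _) ei m.
    have h2 := small (l • i) m; have := small_dist i m; have := ep_le ci.
    move: h1 h2 h; rewrite val_clamp /c /m !epS ler_norml => h1 h2 h h3 h4.
    have := ep_gt0 n0; lra.
  rewrite switch_nonzero //; have := real_dist m n0 (P_real rl).
  by move: hn0; rewrite /m !epS ltr_norml; have := ep_gt0 n0; lra.
exists E => f; case: (hE f) => E1 _; split=> [e|[n z]].
  apply: contrapT => nz; have : E • f = 1 by apply/test => n z; apply: nz; exists n.
  by rewrite e => e'; have := lt01 M; rewrite -e' => /num_ltxx.
case: E1 => [/lt_leS|]; last by move=> /test /(_ n).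
move=> /le_toF; rewrite toFD toF1 => h.
by apply: toF_inj; have := toF_ge0 (E • f); rewrite toF0; lra.
Qed.

End Grilliot.

(** * Number quantifiers decided by (E^2) *)

Section ZeroTest.
Variables (M : model) (E : dom M ty2).
Hypothesis hE : forall f, E • f = 0 <-> exists n, f • n = 0.

Lemma decidable_ex C (Q : tuples M C -> dom M ty0 -> Prop) :
  decidable (fun p : tuples M (cons ty0 C) => Q p.1 p.2) ->
  decidable (fun p => exists n, Q p n).
Proof.
move=> [G [dG GQ]].
exists (fun p => E • Lam (fun i => G (p, i))); split=> [|p].
  apply: definable_app => //; apply: definable_Lam.
  by case: dG => g gE; exists g => -[q x]; exact: gE.
have LE i : Lam (fun i => G (p, i)) • i = G (p, i).
  rewrite LamE //; case: dG => g gE; exists (apps (t := ty1) g p) => x; exact: gE.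
by rewrite hE; split=> -[n h]; exists n; move: h; rewrite LE (GQ (p, n)).
Qed.

Lemma decidable_all C (Q : tuples M C -> dom M ty0 -> Prop) :
  decidable (fun p : tuples M (cons ty0 C) => Q p.1 p.2) ->
  decidable (fun p => forall n, Q p n).
Proof.
move=> /decidable_not dQ.
have := decidable_not (decidable_ex (Q := fun p n => ~ Q p n) dQ).
apply: decidable_iff => p.
by split=> [h n|h [n]//]; apply: contrapT => k; apply: h; exists n.
Qed.

End ZeroTest.

(** * Finite covers in the two cases *)

Section Main.
Variables (M : model) (P : dom M (ty1 ⇒ ty1)).
Local Notation dom := (dom M).
Local Notation num := (dom ty0).
Implicit Types (n m k i j q : num) (x y l d e f g : dom ty1).

Hypotheses (bw : holds (@no_env M) BW_net)
  (P_real : forall x, real x -> real (P • x))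
  (P_ext : forall x y, real x -> real y -> real_eq x y -> real_eq (P • x) (P • y))
  (P_pos : forall x, real x -> exists n, (2 * ep n < val (P • x • n))%R).

(** An index matters only through [d • 0], the length of an initial segment, so the order compares
    two numbers and is decidable outright. The number [i] itself codes the [i]-th rational. *)
Lemma finite_cover_rational :
  (forall l, unit_real l -> exists j m,
     (`|val (l • m) - val (clamp_fun M • j)| + 4 * ep m <
      val (P • const_real (clamp_fun M • j) • m))%R) ->
  finite_cover P.
Proof.
move=> h.
pose K : dom ty2 := Lam (fun d => d • 0).
pose Y : dom (ty1 ⇒ ty0 ⇒ ty1) := Lam (fun d => Lam (fun i => Lam (fun n => clamp_fun M • i))).
have KE d : K • d = d • 0 by rewrite LamE.
have YE d i : Y • d • i = const_real (clamp_fun M • i).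
  by apply: (@model_ext M) => n; rewrite !LamE.
apply: (finite_cover_of_net bw P_real (K := K) (Y := Y) (R := fun d e => d • 0 <= e • 0)).
- by [].
- by right.
- by move=> d e f; apply: le_trans_num.
- by move=> d e; case: (num_le_total (d • 0) (e • 0)) => de; [exists e|exists d]; split=> //; right.
- by move=> d i; rewrite YE; apply: unit_const; rewrite val_clamp clamp_unit.
- move=> l /h [j [m hj]]; exists (const_real (clamp_fun M • j)), m.
  split=> [||N]; [exact: real_const|by rewrite const_realE|].
  (* Long enough both for the required precision [N] and for [j] to occur. *)
  exists (const_real (N + (j + 1))) => e; rewrite const_realE => he; rewrite KE; split.
    by apply: le_trans_num he; apply: le_addr.
  exists j; rewrite YE; split=> //; apply/lt_leS; apply: le_trans_num he.
  by rewrite (plusC N); apply: le_addr.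
Qed.

Section Sequences.
Variable E : dom ty2.
Hypothesis hE : forall f, E • f = 0 <-> exists n, f • n = 0.

(** An arbitrary index may have entries that are not reals, while every [Y • d • i] has to be a
    point of [0, 1]. Being a real is a universal number statement, so (E^2) decides it and other
    entries can be replaced by zero. *)
Lemma regularize : exists r : dom (ty1 ⇒ ty1),
  (forall x, unit_real (r • x)) /\ (forall x, real (clamp_real x) -> r • x = clamp_real x).
Proof.
have dec : decidable (fun p : tuples M (cons ty1 nil) => real (clamp_real p.2)).
  pose Q (p : tuples M (cons ty1 nil)) : Prop := forall n i,
    (val (dist_fun M • (clamp_fun M • (p.2 • n)) • (clamp_fun M • (p.2 • (n + i)))) <
     val (eps_fun M • n))%R.
  apply: (@decidable_iff M _ Q).
    move=> p; rewrite /Q /real; split=> h n i; move: (h n i);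
      by rewrite !clamp_realE val_dist val_eps.
  by apply: (decidable_all hE); cbn beta; apply: (decidable_all hE).
have [c hc] := @decidable_char1 M ty1 (fun x => real (clamp_real x)) dec.
(* A factor [c • x] equal to 0 turns every approximation into the code 0, whose value is 0. *)
exists (Lam (fun x => Lam (fun n => c • x * (clamp_fun M • (x • n))))).
have r1 x : real (clamp_real x) ->
  Lam (fun x => Lam (fun n => c • x * (clamp_fun M • (x • n)))) • x = clamp_real x.
  move=> /(proj2 (hc x)) e; apply: (@model_ext M) => n.
  by rewrite !LamE // e timesC times1.
split=> x; last exact: r1.
have [rx|nrx] := pselect (real (clamp_real x)); first by rewrite r1 //; exact: unit_clamp.
have c0 : c • x = 0.
  case: (hc x) => c1 /iffLR cx; case: c1 => [/lt_leS|/cx //].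
  move=> /le_toF; rewrite toFD toF1 => h; apply: toF_inj.
  by have := toF_ge0 (c • x); rewrite toF0; lra.
have -> : Lam (fun x => Lam (fun n => c • x * (clamp_fun M • (x • n)))) • x = const_real 0.
  by apply: (@model_ext M) => n; rewrite const_realE !LamE // c0 timesC times0.
by apply: unit_const; rewrite val0 lexx ler01.
Qed.

(* [d] codes the finite sequence of the [entry d i] with [i < d • 0]. *)
Definition entry d i : dom ty1 := Lam (fun n => d • (pair_fun M • i • n + 1)).
(** The clause on lengths makes the precision grow along the order; containment of entries alone
    would not, as entries may repeat. Entries are compared code by code, so matching entries give
    the same point. *)
Definition included d e : Prop := d • 0 <= e • 0 /\
  forall i, i < d • 0 -> exists j, j < e • 0 /\
  forall n, d • (pair_fun M • i • n + 1) = e • (pair_fun M • j • n + 1).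

Lemma decidable_included :
  decidable (fun p : tuples M (cons ty1 (cons ty1 nil)) => included p.1.2 p.2).
Proof.
rewrite /included; apply: decidable_and => //; apply: decidable_ball => //; cbn beta.
apply: (decidable_ex hE); cbn beta; apply: decidable_and => //.
by apply: (decidable_all hE).
Qed.

(** Choice serves as definition by cases: position 0 holds the length, and the other positions are
    decoded as pairs. *)
Lemma sequence_exists k (a : dom (ty0 ⇒ ty0 ⇒ ty0)) :
  exists d, d • 0 = k /\ forall i n, d • (pair_fun M • i • n + 1) = a • i • n.
Proof.
have [//|m|d hd] := @num_choice M (fun m v => (m = 0 -> v = k) /\
  (~ m = 0 -> v = a • (pr1_fun M • (pred_fun M • m)) • (pr2_fun M • (pred_fun M • m)))).
  have [->|nz] := pselect (m = 0); first by exists k; split=> // /(_ erefl).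
  by eexists; split=> [/nz []|_]; reflexivity.
exists d; split=> [|i n]; first exact: (hd 0).1.
by rewrite (hd _).2 ?predS ?pr1_pair ?pr2_pair //; exact: S_neq0.
Qed.

Lemma included_directed d e : exists f, included d f /\ included e f.
Proof.
pose k := d • 0.
(* Concatenation: the two factors are the characteristic values of [i < k] and of [k <= i]. *)
have [f [f0 fE]] := sequence_exists (k + e • 0) (Lam (fun i => Lam (fun n =>
  (1 ∸ ((i + 1) ∸ k)) * d • (pair_fun M • i • n + 1) +
  (1 ∸ (k ∸ i)) * e • (pair_fun M • (i ∸ k) • n + 1)))).
have lo i n : i < k -> f • (pair_fun M • i • n + 1) = d • (pair_fun M • i • n + 1).
  move=> ik; rewrite fE !LamE // (_ : i + 1 ∸ k = 0); last exact/monus_eq0/lt_leS.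
  rewrite monus0 monus1_neq0; first by rewrite timesC times1 timesC times0 plus0.
  by move=> /monus_eq0 /(le_lt_tr)/(_ ik) /num_ltxx.
have hi i n : f • (pair_fun M • (i + k) • n + 1) = e • (pair_fun M • i • n + 1).
  have ik : k <= i + k by rewrite plusC; exact: le_addr.
  rewrite fE !LamE // (_ : k ∸ (i + k) = 0); last exact/monus_eq0.
  rewrite monus0 monus1_neq0; last first.
    by move=> /monus_eq0 /lt_leS /(le_lt_tr ik) /num_ltxx.
  have -> : i + k ∸ k = i.
    by apply: toF_inj; rewrite monusF toFD ?addrK // lerDr toF_ge0.
  by rewrite timesC times0 (plusC 0) plus0 timesC times1.
exists f; split; split; rewrite f0.
- exact: le_addr.
- move=> i ik; exists i; split; last by move=> n; rewrite lo.
  by apply/lt_leS; apply: le_trans_num (le_addr _ _); apply/lt_leS.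
- by rewrite plusC; exact: le_addr.
- move=> i ie; exists (i + k); split; last by move=> n; rewrite hi.
  by rewrite (plusC k); exact: lt_plus.
Qed.

Lemma finite_cover_sequences : finite_cover P.
Proof.
have [r [r_unit rE]] := regularize.
pose K : dom ty2 := Lam (fun d => d • 0).
pose Y : dom (ty1 ⇒ ty0 ⇒ ty1) := Lam (fun d => Lam (fun i => r • entry d i)).
have KE d : K • d = d • 0 by rewrite LamE.
have YE d i : Y • d • i = r • entry d i.
  by rewrite /Y /entry !LamE.
apply: (finite_cover_of_net bw P_real (K := K) (Y := Y) (R := included)).
- exact: decidable_included.
- by move=> d; split=> [|i ik]; [right|exists i].
- move=> d e f [h1 h2] [h3 h4]; split=> [|i /h2 [j [/h4 [k [hk ek]] ej]]].
    exact: le_trans_num h3.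
  by exists k; split=> // n; rewrite ej ek.
- exact: included_directed.
- by move=> d i; rewrite YE.
- move=> l l_unit; have rl : real (clamp_real l) by apply: real_clamp; case: l_unit.
  (* The point is its own centre. With [m] for [n + 3], clamping and margin cost at most [6 * ep m],
     that is 6/8 of [ep n], while the radius at [m] exceeds 7/8 of [ep n]. *)
  have [n hn] := P_pos rl; exists (clamp_real l), (n + 1 + 1 + 1); split=> //.
    have := real_dist n (n + 1 + 1 + 1) (P_real rl).
    have := unit_near_clamp (n + 1 + 1 + 1) l_unit.
    rewrite clamp_realE val_clamp distrC ltr_norml !epS; have := ep_gt0 n; lra.
  (* Repeating [l] makes the sequence long enough to force precision [N]. *)
  move=> N; have [d0 [d00 d0E]] := sequence_exists (N + 1) (Lam (fun i => l)).
  exists d0 => e [h1 h2]; rewrite KE; split.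
    by apply: le_trans_num h1; rewrite d00; exact: le_addr.
  have [|j [je jE]] := h2 0.
    by rewrite d00; apply/lt_leS; apply: le_plus; exact: ge0.
  exists j; split=> //; rewrite YE -(rE _ rl); congr (r • _).
  apply: (@model_ext M) => m; rewrite /entry LamE // -jE d0E LamE //.
Qed.

End Sequences.

Lemma finite_cover_exists : finite_cover P.
Proof.
have [h|nh] := pselect (forall l, unit_real l -> exists j m,
     (`|val (l • m) - val (clamp_fun M • j)| + 4 * ep m <
      val (P • const_real (clamp_fun M • j) • m))%R).
  exact: finite_cover_rational.
have [l [l_unit small]] : exists l, unit_real l /\ forall j m,
  (val (P • const_real (clamp_fun M • j) • m) <=
     `|val (l • m) - val (clamp_fun M • j)| + 4 * ep m)%R.
  apply: contrapT => k; apply: nh => l l_unit; apply: contrapT => k'.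
  apply: k; exists l; split=> // j m; rewrite leNgt; apply/negP => lt.
  by apply: k'; exists j, m.
have [E hE] := zero_test P_real P_ext P_pos l_unit small.
exact: finite_cover_sequences hE.
Qed.

End Main.

Lemma holds_close_in (M : structure) V (e : env M V) (A : formula no_vars) :
  holds e (close_in A) <-> holds (@no_env M) A.
Proof.
by rewrite /close_in holds_sub (env_eq (e := fun t v => _) (e' := @no_env M)) // => t [].
Qed.

Theorem theorem3p1 : proves (add_axiom RCA0w BW_net) HBU.
Proof.
apply: completeness.
- by move=> V B; left.
- exact/add_axiom_stable/RCA0w_stable.
move=> N N_ext N_mod.
have N_ax : models RCA0w N by move=> V A e h; apply: N_mod; left.
have bw : holds (@no_env N) BW_net.
  by apply/(holds_close_in (@no_env N)); apply: N_mod; right.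
pose M := Model N_ext N_ax.
by apply: (@holds_HBU M) => P P_real P_ext P_pos; exact: finite_cover_exists.
Qed.
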